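(* Let $p \ge 1$ be an integer and let $Y=(Y_1,\dots,Y_p)'$ be a centered Gaussian random vector in $\mathbb{R}^p$ such that $\mathrm{E}[Y_j^2]\geq \underline{\sigma}^{2}$ for all $j=1,\dots,p$ and some constant $\underline{\sigma}>0$. Then for every $y \in \mathbb{R}^{p}$ and every $\delta > 0$, \[ \mathrm{P}(Y \leq y+\delta)-\mathrm{P}(Y \leq y)\leq \frac{\delta}{\underline{\sigma}} \left(\sqrt{2\log p}+2\right). \]
   Context: For vectors $u,w\in\mathbb{R}^p$, $u \le w$ means $u_j \le w_j$ for all $j=1,\dots,p$. For $y\in\mathbb{R}^p$ and a scalar $\delta$, $y+\delta$ denotes the vector $(y_1+\delta,\dots,y_p+\delta)'$. The covariance matrix of $Y$ is arbitrary (possibly singular) apart from the stated lower bound on its diagonal entries. $\log$ is the natural logarithm. *)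

(* Defs.v *)
From HB Require Import structures.
From mathcomp Require Import all_boot all_order all_algebra.
From mathcomp Require Import all_classical all_reals all_analysis.

Set Implicit Arguments.
Unset Strict Implicit.
Unset Printing Implicit Defensive.

Import Order.TTheory GRing.Theory Num.Theory.
Import numFieldNormedType.Exports.

Local Open Scope classical_set_scope.
Local Open Scope ring_scope.

(* The law N(m, s ^+ 2) on the real line. The case s = 0 is separated because
   normal_prob m 0 is the uniform law on [0, 1], not the point mass at m. *)
Definition gaussian_law (R : realType) (m s : R) (A : set R) : \bar R :=
  if s == 0 then \d_m A else normal_prob m s A.

Definition gaussian_rv (d : measure_display) (T : measurableType d)
    (R : realType) (P : probability T R) (X : T -> R) : Prop :=
  exists m s : R, 0 <= s /\
    forall A : set R, measurable A -> P (X @^-1` A) = gaussian_law m s A.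

(* A random vector in R^p is given by its coordinates. Linear combinations may
   have a degenerate law, so a singular covariance matrix is allowed. *)
Definition gaussian_vector (d : measure_display) (T : measurableType d)
    (R : realType) (P : probability T R) (p : nat)
    (Y : 'I_p -> {RV P >-> R}) : Prop :=
  forall a : 'rV[R]_p,
    gaussian_rv P (fun omega => \sum_(j < p) a ord0 j * Y j omega).

Definition centered (d : measure_display) (T : measurableType d)
    (R : realType) (P : probability T R) (p : nat)
    (Y : 'I_p -> {RV P >-> R}) : Prop :=
  forall j : 'I_p, ('E_P[Y j] = 0)%E.

(* Main.v *)
Require Import Defs.
From HB Require Import structures.
From mathcomp Require Import all_boot all_order all_algebra.
From mathcomp Require Import all_classical all_reals all_analysis.
From mathcomp Require Import measurable_realfun ring lra.

Import Order.TTheory GRing.Theory Num.Theory.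
Import numFieldNormedType.Exports.

Local Open Scope classical_set_scope.
Local Open Scope ring_scope.

(** Anti-concentration of a Gaussian vector near the boundary of an orthant
    (Nazarov inequality).

    Put D k = Y k - y k. The event whose probability is bounded says that
    max_k D k lies in ]0, delta]. Split it according to the first index j at
    which the maximum is attained. With c k j = Cov(Y k, Y j) / Var(Y j), the
    residuals Y k - c k j Y j are independent of Y j, so conditioning on
    Y j = y j + t and integrating over t turns the probability of the piece of
    index j into the integral over ]0, delta] of

      P(face j t) * (density of Y j at y j + t),

    where face j t only constrains the residuals. It remains to bound, for each
    fixed t, the sum over j of these products by (a + 2) / sigma, where
    a = sqrt(2 ln p).

    - If y j + t > a * stdev j, the density is at most 1 / (sigma p), because
      exp(- a ^ 2 / 2) = 1 / p; these terms contribute at most 1 / sigma.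
    - Otherwise the Mills ratio bound [normal_pdf_le_tail] replaces the density
      by (a + 1) / sigma times P(Y j > y j + t). By independence the product
      becomes the probability of the prism standing on the face j, orthogonally
      to it. Prisms over distinct faces are disjoint
      ([face_prism_disjoint], from Cauchy-Schwarz), so these terms contribute
      at most (a + 1) / sigma.

    No density of Y is used, so a singular covariance is harmless; faces that
    coincide are told apart by strict inequalities in [face].

    The law of Y is only known through its linear combinations, hence the
    independence of Y j and the residuals has to be extracted from
    one-dimensional laws. A linear combination Z satisfies
    E cos(Z + g) = exp(- Var Z / 2) cos g, so the expectation of
    cos(z) cos(w) factorizes when z and w are uncorrelated. Both sides of
    this factorization are stable under linear combinations and bounded
    pointwise limits, and the indicators of the events generated by a family
    of linear combinations are obtained from cosines in this way
    ([bounded_closure_cos_sigma_algebra]), which gives [independent_of_cos]. *)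

(** * The Gaussian density *)

(** The fundamental theorem of calculus on [m - n, m + n]: the growth bound
    makes the boundary values O(1 / n). Every integration by parts below is an
    instance of this lemma. *)
Lemma Rintegral_derive_eq0 {R : realType} (F f : R -> R) (m C : R) :
  (forall x : R, is_derive x (1 : R) F (f x)) -> continuous f ->
  (@lebesgue_measure R).-integrable setT (EFin \o f) ->
  (forall x, `|x - m| * `|F x| <= C) ->
  (\int[@lebesgue_measure R]_x f x = 0)%R.
Proof.
move=> dF cf intf bF.
set mu := @lebesgue_measure R.
pose I n : set R := `[m - n.+1%:R, m + n.+1%:R]%classic.
have IE n : (\int[mu]_(x in I n) (f x)%:E =
    (F (m + n.+1%:R) - F (m - n.+1%:R))%:E)%E.
  rewrite EFinB; apply: continuous_FTC2.
  - by rewrite ltrD2l gtrN.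
  - exact: continuous_subspaceT.
  - split.
    + by move=> x _; apply: ex_derive.
    + apply: cvg_at_right_filter; apply: differentiable_continuous.
      by apply/derivable1_diffP; apply: ex_derive.
    + apply: cvg_at_left_filter; apply: differentiable_continuous.
      by apply/derivable1_diffP; apply: ex_derive.
  - by move=> x _; rewrite derive1E; apply: derive_val.
have C0 : 0 <= C by apply: le_trans (bF 0); rewrite mulr_ge0.
have lim0 : F (m + n.+1%:R) - F (m - n.+1%:R) @[n --> \oo] --> 0.
  apply/norm_cvg0P.
  apply: (@squeeze_cvgr _ _ _ _ (cst 0) (fun n => (2 * C) * n.+1%:R^-1)).
  - apply: nearW => n /=; rewrite normr_ge0/=.
    have h1 : `|F (m + n.+1%:R)| <= C * n.+1%:R^-1.
      rewrite ler_pdivlMr// mulrC; apply: le_trans (bF (m + n.+1%:R)).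
      by rewrite addrAC subrr add0r normr_nat.
    have h2 : `|F (m - n.+1%:R)| <= C * n.+1%:R^-1.
      rewrite ler_pdivlMr// mulrC; apply: le_trans (bF (m - n.+1%:R)).
      by rewrite addrAC subrr add0r normrN normr_nat.
    by apply: (le_trans (ler_normB _ _)); rewrite -mulrA mulr_natl mulr2n lerD.
  - exact: (@cvg_cst R^o).
  - have : (2 * C) * n.+1%:R^-1 @[n --> \oo] --> (2 * C) * (0 : R).
      by apply: cvgMr; exact: cvg_harmonic.
    by rewrite mulr0.
have limf : (\int[mu]_(x in I n) (f x)%:E @[n --> \oo] --> \int[mu]_x (f x)%:E)%E.
  under eq_fun do rewrite integral_mkcond.
  apply: (@dominated_cvg _ _ _ mu _ measurableT _ _ (abse \o (EFin \o f))) => //=.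
  - move=> n; apply/(measurable_restrictT _ _).1; first exact: measurable_itv.
    by apply: measurable_funTS; exact: (measurable_int _ intf).
  - move=> x _; apply: cvg_near_cst; near=> n.
    rewrite patchE mem_set// /I /= in_itv/=.
    have : `|x - m| <= n%:R by near: n; exact: nbhs_infty_ger.
    rewrite ler_norml => /andP[h1 h2]; rewrite -natr1.
    by apply/andP; split; lra.
  - exact: integrable_abse.
  - by move=> n x _; rewrite patchE; case: ifPn => // _; rewrite abse0 lee_fin.
have : (\int[mu]_(x in I n) (f x)%:E @[n --> \oo] --> 0)%E.
  under eq_fun do rewrite IE.
  by apply: cvg_EFin; [exact: nearW|exact: lim0].
move=> /(cvg_unique _ limf); rewrite /Rintegral => -> //.
Unshelve. all: end_near. Qed.

Lemma is_derive_normal_pdf {R : realType} (m s : R) : s != 0 ->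
  forall x : R, is_derive x (1 : R) (normal_pdf m s)
    (- ((x - m) / s ^+ 2) * normal_pdf m s x).
Proof.
move=> s0 x; rewrite normal_pdfE// /normal_fun.
have -> : (fun x => normal_peak s * expR (- (x - m) ^+ 2 / (s ^+ 2 *+ 2))) =
  normal_peak s \*: (expR \o (fun x => - (x - m) ^+ 2 / (s ^+ 2 *+ 2))) by [].
set q := (fun x : R => - (x - m) ^+ 2 / (s ^+ 2 *+ 2)).
have dq : is_derive x (1 : R) q (- ((x - m) / s ^+ 2)).
  rewrite /q; apply: is_derive_eq.
  rewrite /GRing.scale/=; field.
  by rewrite s0.
apply: is_derive_eq.
by rewrite /GRing.scale/= mulrA mulrC.
Qed.

(** Doubling the standard deviation absorbs a quadratic factor, so that
    integrability against N(m, s ^ 2) up to quadratic growth reduces to the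
    integrability of the density of N(m, 4 s ^ 2). *)
Lemma sqr_normal_pdf_le {R : realType} (m s x : R) : s != 0 ->
  (x - m) ^+ 2 * normal_pdf m s x <=
  4 * s ^+ 2 * (normal_peak s / normal_peak (2 * s)) * normal_pdf m (2 * s) x.
Proof.
move=> s0; have s20 : 2 * s != 0 by rewrite mulf_neq0.
have sq0 : 0 < s ^+ 2 by rewrite exprn_even_gt0.
rewrite !normal_pdfE// [leRHS]mulrA mulrA.
have -> : 4 * s ^+ 2 * (normal_peak s / normal_peak (2 * s)) * normal_peak (2 * s)
  = normal_peak s * (4 * s ^+ 2).
  by rewrite -mulrA divfK ?gt_eqF ?normal_peak_gt0// mulrC.
rewrite -mulrA mulrCA -[leRHS]mulrA ler_wpM2l ?normal_peak_ge0//.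
set v := (x - m) ^+ 2 / s ^+ 2.
have vE : (x - m) ^+ 2 = v * s ^+ 2 by rewrite /v divfK// gt_eqF.
have v0 : 0 <= v by rewrite /v divr_ge0// sqr_ge0.
(* the exponent - v / 2 is split into - v / 8, which is that of N(m, 4 s ^ 2),
   and - 3 v / 8, which absorbs v since v * exp (- 3 v / 8) <= 8 / 3 *)
have -> : normal_fun m s x = expR (- (v / 8)) * expR (- (3 * v / 8)).
  by rewrite -expRD; congr expR; rewrite vE; field.
have -> : normal_fun m (2 * s) x = expR (- (v / 8)).
  by congr expR; rewrite vE; field.
rewrite vE [leLHS]mulrCA [leRHS]mulrC ler_wpM2l ?expR_ge0//.
rewrite mulrAC ler_wpM2r ?(ltW sq0)//.
have := expR_ge1Dx (3 * v / 8).
rewrite expRN ler_pdivrMr ?expR_gt0//.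
by move: (expR_gt0 (3 * v / 8)) => ? ?; lra.
Qed.

Lemma sqr_normal_pdf_bounded {R : realType} (m s x : R) : s != 0 ->
  (x - m) ^+ 2 * normal_pdf m s x <= 4 * s ^+ 2 * normal_peak s.
Proof.
move=> s0; have s20 : 2 * s != 0 by rewrite mulf_neq0.
apply: (le_trans (sqr_normal_pdf_le m s x s0)).
have p0 := normal_peak_gt0 s20.
have -> : 4 * s ^+ 2 * normal_peak s =
    4 * s ^+ 2 * (normal_peak s / normal_peak (2 * s)) * normal_peak (2 * s).
  by rewrite -[RHS]mulrA divfK ?gt_eqF.
rewrite ler_wpM2l ?normal_pdf_ub//.
rewrite mulr_ge0 ?divr_ge0 ?normal_peak_ge0// mulr_ge0 ?sqr_ge0//.
Qed.

Lemma normr_normal_pdf_bounded {R : realType} (m s x : R) : s != 0 ->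
  `|x - m| * normal_pdf m s x <= (1 + 4 * s ^+ 2) * normal_peak s.
Proof.
move=> s0; apply: (@le_trans _ _ ((1 + (x - m) ^+ 2) * normal_pdf m s x)).
  rewrite ler_wpM2r ?normal_pdf_ge0// -real_normK ?num_real//.
  by have := normr_ge0 (x - m); have := sqr_ge0 (`|x - m| - 1); nra.
rewrite [leLHS]mulrDl [leRHS]mulrDl !mul1r.
by apply: lerD; [exact: normal_pdf_ub|exact: sqr_normal_pdf_bounded].
Qed.

Lemma integrable_mul_normal_pdf {R : realType} (m s A B : R) (h : R -> R) :
  s != 0 -> measurable_fun setT h ->
  (forall x, `|h x| <= A + B * (x - m) ^+ 2) ->
  (@lebesgue_measure R).-integrable setT
    (EFin \o (fun x => h x * normal_pdf m s x)).
Proof.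
move=> s0 mh hb; have s20 : 2 * s != 0 by rewrite mulf_neq0.
pose K := `|B| * (4 * s ^+ 2 * (normal_peak s / normal_peak (2 * s))).
have ig : (@lebesgue_measure R).-integrable setT (fun x : R =>
    A%:E * (normal_pdf m s x)%:E + K%:E * (normal_pdf m (2 * s) x)%:E)%E.
  by apply: integrableD => //; apply: integrableZl => //;
    exact: integrable_normal_pdf.
apply: le_integrable ig => //.
- apply/measurable_EFinP/measurable_funM => //; exact: measurable_normal_pdf.
- move=> x _; rewrite /= lee_fin normrM (ger0_norm (normal_pdf_ge0 _ _ _)).
  apply: le_trans (ler_norm _).
  apply: (le_trans (ler_wpM2r (normal_pdf_ge0 m s x) (hb x))).
  rewrite mulrDl lerD2l /K -[leLHS]mulrA -[leRHS]mulrA.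
  have := sqr_normal_pdf_le m s x s0.
  set q := _ * normal_pdf m s x; set q' := _ * normal_pdf m (2 * s) x => qq'.
  have q0 : 0 <= q by rewrite mulr_ge0 ?sqr_ge0 ?normal_pdf_ge0.
  apply: (@le_trans _ _ (`|B| * q)); first by rewrite ler_wpM2r// ler_norm.
  by rewrite ler_wpM2l.
Qed.

(** The integrand is the derivative of - s ^ 2 * normal_pdf m s. *)
Lemma normal_pdf_mean {R : realType} (m s : R) : s != 0 ->
  \int[@lebesgue_measure R]_x ((x - m) * normal_pdf m s x) = 0.
Proof.
move=> s0; have sq0 : 0 < s ^+ 2 by rewrite exprn_even_gt0.
apply: (@Rintegral_derive_eq0 _ (fun x => - s ^+ 2 * normal_pdf m s x)
  (fun x => (x - m) * normal_pdf m s x) m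
  (s ^+ 2 * ((1 + 4 * s ^+ 2) * normal_peak s))).
- move=> x; have := is_derive_normal_pdf m s s0 x => ?.
  apply: is_derive_eq; rewrite /GRing.scale/=.
  by field.
- move=> x; apply: cvgM; last exact: continuous_normal_pdf.
  by apply: (@cvgB _ R^o); [exact: cvg_id|exact: cvg_cst].
- apply: (@integrable_mul_normal_pdf _ m s 1 1) => //.
    exact: measurable_funB.
  move=> x; rewrite -[in leRHS]real_normK ?num_real//.
  by have := normr_ge0 (x - m); have := sqr_ge0 (`|x - m| - 1); nra.
- move=> x; rewrite normrM normrN (ger0_norm (sqr_ge0 _)) mulrCA.
  rewrite ler_wpM2l ?sqr_ge0// (ger0_norm (normal_pdf_ge0 _ _ _)).
  exact: normr_normal_pdf_bounded.
Qed.

(** The difference of the two integrands below is the derivative of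
    - s ^ 2 * (x - m) * normal_pdf m s x. *)
Lemma normal_pdf_moment2 {R : realType} (m s : R) : s != 0 ->
  \int[@lebesgue_measure R]_x ((x - m) ^+ 2 * normal_pdf m s x) = s ^+ 2.
Proof.
move=> s0; have sq0 : 0 < s ^+ 2 by rewrite exprn_even_gt0.
have i2 : (@lebesgue_measure R).-integrable setT
    (EFin \o (fun x => (x - m) ^+ 2 * normal_pdf m s x)).
  apply: (@integrable_mul_normal_pdf _ m s 0 1) => //.
    by apply: measurable_funX; exact: measurable_funB.
  by move=> x; rewrite ger0_norm ?sqr_ge0// add0r mul1r.
have i0 := @integrable_normal_pdf R m s.
have : \int[@lebesgue_measure R]_x
    ((x - m) ^+ 2 * normal_pdf m s x - s ^+ 2 * normal_pdf m s x) = 0.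
  apply: (@Rintegral_derive_eq0 _
      (fun x => (- s ^+ 2 * (x - m)) * normal_pdf m s x)
      (fun x => (x - m) ^+ 2 * normal_pdf m s x - s ^+ 2 * normal_pdf m s x) m
      (s ^+ 2 * (4 * s ^+ 2 * normal_peak s))).
  - move=> x; have := is_derive_normal_pdf m s s0 x => ?.
    apply: is_derive_eq; rewrite /GRing.scale/=.
    by field.
  - move=> x; apply: (@cvgB _ R^o); apply: cvgM;
      try exact: continuous_normal_pdf; try exact: cvg_cst.
    apply: (@continuous_comp _ _ _ (fun x => x - m) (fun x => x ^+ 2)).
      by apply: (@cvgB _ R^o); [exact: cvg_id|exact: cvg_cst].
    exact: sqr_continuous.
  - rewrite [X in _.-integrable _ X](_ : _ = (fun x =>
      ((x - m) ^+ 2 * normal_pdf m s x)%:E - (s ^+ 2)%:E * (normal_pdf m s x)%:E)%E).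
      by apply: integrableB => //; exact: integrableZl.
    by apply/funext => x.
  - move=> x; rewrite !normrM normrN (ger0_norm (sqr_ge0 s)) -mulrA mulrCA.
    rewrite ler_wpM2l ?sqr_ge0// (ger0_norm (normal_pdf_ge0 _ _ _)) mulrA.
    by rewrite -expr2 real_normK ?num_real// sqr_normal_pdf_bounded.
have i0' : (@lebesgue_measure R).-integrable setT
    (EFin \o (fun x => s ^+ 2 * normal_pdf m s x)).
  apply: (@integrable_mul_normal_pdf _ m s (s ^+ 2) 0) => // x.
  by rewrite mul0r addr0 ger0_norm ?sqr_ge0.
rewrite RintegralB//.
rewrite RintegralZl// => /eqP; rewrite subr_eq0 => /eqP ->.
by rewrite /Rintegral integral_normal_pdf/= mulr1.
Qed.

(** Stein identity E[X f(X)] = s ^ 2 E[f'(X)] for f x = sin (t x + g). *)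
Lemma normal_pdf_stein_sin {R : realType} (s t g : R) : s != 0 ->
  \int[@lebesgue_measure R]_x (- x * sin (t * x + g) * normal_pdf 0 s x) =
  - (s ^+ 2 * t) *
    \int[@lebesgue_measure R]_x (cos (t * x + g) * normal_pdf 0 s x).
Proof.
move=> s0; have sq0 : 0 < s ^+ 2 by rewrite exprn_even_gt0.
have ml : measurable_fun setT (fun x : R => t * x + g).
  by apply: measurable_funD => //; exact: measurable_funM.
have mcos : measurable_fun setT (fun x : R => cos (t * x + g)).
  apply: measurableT_comp ml; apply: continuous_measurable_fun.
  exact: continuous_cos.
have msin : measurable_fun setT (fun x : R => sin (t * x + g)).
  apply: measurableT_comp ml; apply: continuous_measurable_fun.
  exact: continuous_sin.
have ic : (@lebesgue_measure R).-integrable setT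
    (EFin \o (fun x => cos (t * x + g) * normal_pdf 0 s x)).
  apply: (@integrable_mul_normal_pdf _ 0 s 1 0) => // x.
  by rewrite mul0r addr0 ler_norml cos_geN1 cos_le1.
have ixs : (@lebesgue_measure R).-integrable setT
    (EFin \o (fun x => (- x * sin (t * x + g)) * normal_pdf 0 s x)).
  apply: (@integrable_mul_normal_pdf _ 0 s 1 1) => //.
    by apply: measurable_funM => //; exact: measurable_funN.
  move=> x; rewrite subr0 mul1r normrM normrN.
  have : `|sin (t * x + g)| <= 1 by rewrite ler_norml sin_geN1 sin_le1.
  move=> s1; rewrite -[in leRHS]real_normK ?num_real//.
  have := normr_ge0 x; have := normr_ge0 (sin (t * x + g)).
  by have := sqr_ge0 (`|x| - 1); nra.
have : \int[@lebesgue_measure R]_x ((s ^+ 2 * t) * (cos (t * x + g) * normal_pdf 0 s x)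
   + (- x * sin (t * x + g) * normal_pdf 0 s x)) = 0.
  apply: (@Rintegral_derive_eq0 _
    (fun x => s ^+ 2 * sin (t * x + g) * normal_pdf 0 s x)
    (fun x => (s ^+ 2 * t) * (cos (t * x + g) * normal_pdf 0 s x)
     + (- x * sin (t * x + g) * normal_pdf 0 s x)) 0
     (s ^+ 2 * ((1 + 4 * s ^+ 2) * normal_peak s))).
  - move=> x; have := is_derive_normal_pdf 0 s s0 x => ?.
    apply: is_derive_eq; rewrite /GRing.scale/=.
    by field.
  - have cl : continuous (fun x : R => t * x + g).
      move=> x; apply: (@cvgD _ R^o); last exact: cvg_cst.
      by apply: cvgM; [exact: cvg_cst|exact: cvg_id].
    have cp := @continuous_normal_pdf R 0 s s0.
    move=> x; apply: (@cvgD _ R^o); apply: cvgM; try exact: cvg_cst;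
      try exact: cp.
      apply: cvgM; last exact: cp.
      by apply: (continuous_comp (cl x)); exact: continuous_cos.
    apply: cvgM; first by apply: (@cvgN _ R^o); exact: cvg_id.
    by apply: (continuous_comp (cl x)); exact: continuous_sin.
  - rewrite [X in _.-integrable _ X](_ : _ = (fun x =>
      (s ^+ 2 * t)%:E * (cos (t * x + g) * normal_pdf 0 s x)%:E +
      (- x * sin (t * x + g) * normal_pdf 0 s x)%:E)%E).
      by apply: integrableD => //; exact: integrableZl.
    by apply/funext => x.
  - move=> x; rewrite subr0 normrM (normrM (s ^+ 2)) (ger0_norm (sqr_ge0 s)).
    rewrite mulrCA -[leLHS]mulrA ler_wpM2l ?sqr_ge0// mulrCA.
    rewrite (ger0_norm (normal_pdf_ge0 _ _ _)).
    have := normr_normal_pdf_bounded 0 s x s0; rewrite subr0; apply: le_trans.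
    rewrite ler_wpM2l// ler_piMl ?normal_pdf_ge0//.
    by rewrite ler_norml sin_geN1 sin_le1.
rewrite RintegralD//; last first.
  by have := @integrableZl _ _ _ _ setT measurableT (s ^+ 2 * t) _ ic.
rewrite RintegralZl// => /eqP; rewrite addr_eq0 => /eqP h.
by rewrite mulNr h opprK.
Qed.

(** The characteristic function of N(0, s ^ 2), the phase g giving its real and
    imaginary parts at once. As a function of the frequency t, the integral G t
    of cos (t x + g) solves G' = - s ^ 2 t G by the Stein identity, hence
    G t * exp(s ^ 2 t ^ 2 / 2) is constant. *)
Lemma normal_pdf_cos {R : realType} (s g : R) : s != 0 ->
  \int[@lebesgue_measure R]_x (cos (x + g) * normal_pdf 0 s x) =
  expR (- (s ^+ 2 / 2)) * cos g.
Proof.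
move=> s0; have sq0 : 0 < s ^+ 2 by rewrite exprn_even_gt0.
pose f (t x : R) := cos (t * x + g) * normal_pdf 0 s x.
pose G (t : R) := \int[@lebesgue_measure R]_x f t x.
have mf t : measurable_fun setT (fun x : R => cos (t * x + g)).
  apply: continuous_measurable_fun => x.
  apply: (@continuous_comp _ _ _ (fun x => t * x + g)).
    apply: (@cvgD _ R^o); last exact: cvg_cst.
    by apply: cvgM; [exact: cvg_cst|exact: cvg_id].
  exact: continuous_cos.
have intf t : (@lebesgue_measure R).-integrable setT (EFin \o f t).
  apply: (@integrable_mul_normal_pdf _ 0 s 1 0) => // x.
  by rewrite mul0r addr0 ler_norml cos_geN1 cos_le1.
have df t x : is_derive t (1 : R) (f ^~ x) (- x * sin (t * x + g) * normal_pdf 0 s x).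
  rewrite /f; apply: is_derive_eq; rewrite /GRing.scale/=.
  by ring.
have pf t x : partial1of2 f t x = - x * sin (t * x + g) * normal_pdf 0 s x.
  by rewrite partial1of2E; apply: derive_val.
have dG t : is_derive t (1 : R) G (- (s ^+ 2 * t) * G t).
  have iD : (@lebesgue_measure R).-integrable setT
      (EFin \o (fun x : R => `|x| * normal_pdf 0 s x)).
    apply: (@integrable_mul_normal_pdf _ 0 s 1 1) => //.
    move=> x; rewrite subr0 normr_id mul1r -[in leRHS]real_normK ?num_real//.
    by have := normr_ge0 x; have := sqr_ge0 (`|x| - 1); nra.
  have It : `]t - 1, t + 1[%classic t by rewrite /= in_itv/=; apply/andP; split; lra.
  have dfv t' x : `]t - 1, t + 1[%classic t' -> setT x -> derivable (f ^~ x) t' 1.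
    by move=> _ _; apply: ex_derive.
  have dfb t' x : `]t - 1, t + 1[%classic t' -> setT x ->
      `|partial1of2 f t' x| <= `|x| * normal_pdf 0 s x.
    move=> _ _; rewrite pf normrM normrM normrN -mulrA ler_wpM2l//.
    rewrite (ger0_norm (normal_pdf_ge0 _ _ _)) ler_piMl ?normal_pdf_ge0//.
    by rewrite ler_norml sin_geN1 sin_le1.
  have D0 (x : R) : 0 <= `|x| * normal_pdf 0 s x by rewrite mulr_ge0 ?normal_pdf_ge0.
  have dvG := derivable_under_integral measurableT It (fun t' _ => intf t') dfv D0 iD dfb.
  have G' := differentiation_under_integral measurableT It (fun t' _ => intf t')
    dfv D0 iD dfb.
  apply: (@DeriveDef _ _ _ _ _ _ _ dvG).
  rewrite -derive1E G' -normal_pdf_stein_sin//.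
  by apply: eq_Rintegral => x _; rewrite pf.
pose H t := G t * expR (s ^+ 2 * t ^+ 2 / 2).
have dH t : is_derive t (1 : R) H 0.
  rewrite /H; have := dG t => ?.
  apply: is_derive_eq; rewrite /GRing.scale/=.
  by field.
have : H 1 = H 0 by exact: is_derive_0_is_cst.
rewrite /H expr1n mulr1 expr0n/= mulr0 mul0r expR0 mulr1.
have -> : G 0 = cos g.
  rewrite /G /f.
  under eq_Rintegral do rewrite mul0r add0r.
  rewrite RintegralZl//; last exact: integrable_normal_pdf.
  by rewrite /Rintegral integral_normal_pdf/= mulr1.
move=> <-; rewrite mulrCA -expRD addNr expR0 mulr1 /G /f.
by apply: eq_Rintegral => x _; rewrite mul1r.
Qed.

(** Lower Mills bound: the function s ^ 2 / (x + s) * normal_pdf 0 s x vanishes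
    at infinity and decreases no faster than the tail, since minus its
    derivative is normal_pdf 0 s x times
    (x (x + s) + s ^ 2) / (x + s) ^ 2 <= 1. *)
Lemma normal_tail_lb {R : realType} (s h : R) : 0 < s -> 0 <= h ->
  ((s ^+ 2 / (h + s) * normal_pdf 0 s h)%:E <= normal_prob 0 s `]h, +oo[%classic)%E.
Proof.
move=> s0 h0; have sn0 : s != 0 by rewrite gt_eqF.
pose F (x : R) := - s ^+ 2 * ((x + s)^-1 * normal_pdf 0 s x).
pose f (x : R) := (x / (x + s) + s ^+ 2 / (x + s) ^+ 2) * normal_pdf 0 s x.
have xs0 x : h <= x -> 0 < x + s by move=> hx; lra.
have dF x : h <= x -> is_derive x (1 : R) F (f x).
  move=> /xs0 xs; have := is_derive_normal_pdf 0 s sn0 x => ?.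
  have xsn0 : x + s != 0 by rewrite gt_eqF.
  have dv : is_derive x (1 : R) (fun x => (x + s)^-1) (- (x + s) ^- 2).
    have := @is_deriveV R (fun x => x + s) x 1 1 xsn0.
    rewrite /GRing.scale/= mulr1; apply.
    by apply: is_derive_eq; rewrite addr0.
  apply: is_derive_eq; rewrite /f /GRing.scale/=.
  by field; rewrite xsn0 sn0.
have cf x : h <= x -> {for x, continuous f}.
  move=> /xs0 xs; have xsn0 : x + s != 0 by rewrite gt_eqF.
  have cxs : {for x, continuous (fun x : R => x + s)}.
    by apply: (@cvgD _ R^o); [exact: cvg_id|exact: cvg_cst].
  apply: cvgM; last exact: continuous_normal_pdf.
  apply: (@cvgD _ R^o); apply: cvgM; try exact: cvg_id; try exact: cvg_cst.
    by apply: cvgV.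
  apply: cvgV; first by rewrite expf_neq0.
  by apply: (@continuous_comp _ _ _ (fun x => x + s) (fun x => x ^+ 2));
    [exact: cxs|exact: sqr_continuous].
have cF x : h <= x -> {for x, continuous F}.
  move=> hx; apply/differentiable_continuous/derivable1_diffP.
  by have [] := dF x hx.
have limF : F x @[x --> +oo%R] --> (0 : R).
  have -> : (0 : R) = - s ^+ 2 * 0 by rewrite mulr0.
  apply: cvgMr.
  apply: (@squeeze_cvgr _ _ _ _ (cst 0) (fun x => (x + s)^-1 * normal_peak s)).
  - near=> x; have xs : 0 < x + s.
      by apply: xs0; near: x; apply: nbhs_pinfty_ge; exact: num_real.
    have xsV : 0 <= (x + s)^-1 by rewrite invr_ge0 ltW.
    by rewrite mulr_ge0 ?normal_pdf_ge0//= ler_wpM2l ?normal_pdf_ub.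
  - exact: (@cvg_cst R^o).
  - have -> : (0 : R) = 0 * normal_peak s by rewrite mul0r.
    apply: cvgMl; apply/gtr0_cvgV0; last exact: cvg_addrr.
    by near=> x; apply: xs0; near: x; apply: nbhs_pinfty_ge; exact: num_real.
have f0 x : h <= x -> 0 <= f x.
  move=> hx; rewrite mulr_ge0 ?normal_pdf_ge0// addr_ge0//.
    by rewrite divr_ge0 ?(le_trans h0 hx) ?(ltW (xs0 _ hx)).
  by rewrite divr_ge0 ?sqr_ge0.
have ffx : (\int[@lebesgue_measure R]_(x in `[h, +oo[) (f x)%:E =
    (s ^+ 2 / (h + s) * normal_pdf 0 s h)%:E)%E.
  rewrite (@ge0_continuous_FTC2y _ f F h 0 f0 _ limF).
  - by rewrite -EFinB sub0r /F mulNr opprK mulrA.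
  - apply: continuous_in_subspaceT => x; rewrite inE/= in_itv/= andbT.
    exact: cf.
  - by move=> x hx; have [] := dF x (ltW hx).
  - by apply: cvg_at_right_filter; exact: cF.
  - move=> x; rewrite in_itv/= andbT => hx; rewrite derive1E.
    by have [_] := dF x (ltW hx).
have mp : measurable_fun `[h, +oo[ (fun x => (normal_pdf 0 s x)%:E).
  apply: measurable_funTS; apply/measurable_EFinP; exact: measurable_normal_pdf.
rewrite -ffx /normal_prob integral_itv_obnd_cbnd; last first.
  apply: measurable_funTS; apply/measurable_EFinP; exact: measurable_normal_pdf.
apply: ge0_le_integral => //.
- by move=> x; rewrite /= in_itv/= andbT => hx; rewrite lee_fin f0.
- apply/measurable_EFinP; apply: subspace_continuous_measurable_fun => //.
  apply: continuous_in_subspaceT => x; rewrite inE/= in_itv/= andbT.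
  exact: cf.
- move=> x; rewrite /= in_itv/= andbT => hx; rewrite lee_fin.
  rewrite /f ler_piMl ?normal_pdf_ge0//.
  have xs := xs0 x hx; have x0 : 0 <= x by exact: le_trans hx.
  have -> : x / (x + s) + s ^+ 2 / (x + s) ^+ 2 =
      (x * (x + s) + s ^+ 2) / (x + s) ^+ 2.
    by field; rewrite gt_eqF.
  rewrite ler_pdivrMr ?exprn_gt0// mul1r.
  by nra.
Unshelve. all: by end_near. Qed.

(** The Mills bound extends to negative x by comparison with 0, where the
    density is larger and the tail smaller. *)
Lemma normal_pdf_le_tail {R : realType} (s a x : R) : 0 < s -> 0 <= a ->
  x <= a * s ->
  ((normal_pdf 0 s x)%:E <= ((a + 1) / s)%:E * normal_prob 0 s `]x, +oo[%classic)%E.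
Proof.
move=> s0 a0 xa; have sn0 : s != 0 by rewrite gt_eqF.
pose h := Num.max x 0.
have h0 : 0 <= h by rewrite le_max lexx orbT.
have ha : h <= a * s by rewrite ge_max xa mulr_ge0// ltW.
apply: (@le_trans _ _ (normal_pdf 0 s h)%:E).
  rewrite lee_fin /h; have [x0|//] := leP x 0.
  rewrite !normal_pdfE// ler_wpM2l ?normal_peak_ge0//.
  rewrite ler_expR ler_pM2r ?invr_gt0 ?pmulrn_lgt0 ?exprn_gt0//.
  by rewrite lerN2 !subr0 expr0n/= sqr_ge0.
apply: (@le_trans _ _ (((a + 1) / s)%:E * normal_prob 0 s `]h, +oo[%classic)%E).
  apply: le_trans; last first.
    apply: lee_wpmul2l; last exact: normal_tail_lb.
    by rewrite lee_fin divr_ge0 ?addr_ge0// ltW.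
  rewrite -EFinM lee_fin mulrA ler_peMl ?normal_pdf_ge0//.
  have hs : 0 < h + s by lra.
  have -> : (a + 1) / s * (s ^+ 2 / (h + s)) = ((a + 1) * s) / (h + s).
    by field; rewrite sn0 gt_eqF.
  by rewrite ler_pdivlMr// mul1r; lra.
apply: lee_wpmul2l; first by rewrite lee_fin divr_ge0 ?addr_ge0// ltW.
apply: le_measure; rewrite ?inE//; do ?exact: measurable_itv.
by apply: subset_itvr; rewrite bnd_simp le_max lexx.
Qed.

(** * Integration against a Gaussian law *)

Section density.
Import HBNNSimple.
Local Open Scope ereal_scope.

Lemma ge0_integral_density {d} {T : measurableType d} {R : realType}
    (mu nu : {measure set T -> \bar R}) (p : T -> R) (f : T -> \bar R) :
  measurable_fun setT p -> (forall x, 0 <= p x)%R ->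
  (forall A, measurable A -> nu A = \int[mu]_(x in A) (p x)%:E) ->
  measurable_fun setT f -> (forall x, 0 <= f x) ->
  \int[nu]_x f x = \int[mu]_x (f x * (p x)%:E).
Proof.
move=> mp p0 nuE mf f0.
pose f_ := nnsfun_approx measurableT mf.
have mfp n : measurable_fun setT (fun x => (f_ n x)%:E * (p x)%:E).
  by apply: emeasurable_funM; exact/measurable_EFinP.
transitivity (limn (fun n => \int[nu]_x (f_ n x)%:E)).
  rewrite -monotone_convergence//=.
  - apply: eq_integral => ? /[!inE] xD; apply/esym/cvg_lim => //=.
    exact: cvg_nnsfun_approx.
  - by move=> n; exact/measurable_EFinP/measurable_funTS.
  - by move=> n ? _; rewrite lee_fin.
  - by move=> ? _ ? ? mn; rewrite lee_fin; exact/lefP/nd_nnsfun_approx.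
transitivity (limn (fun n => \int[mu]_x ((f_ n x)%:E * (p x)%:E))); last first.
  rewrite -monotone_convergence//=.
  - apply: eq_integral => x _; apply/cvg_lim => //.
    apply: cvgeZr => //.
    by apply: cvg_nnsfun_approx.
  - by move=> n x _; rewrite mule_ge0 ?lee_fin.
  - move=> x _ a b ab; rewrite lee_wpmul2r ?lee_fin//.
    exact/lefP/nd_nnsfun_approx.
apply: congr_lim; apply/funext => n /=.
under eq_integral do rewrite fimfunE -fsumEFin//.
rewrite [LHS]ge0_integral_fsum//; last 2 first.
  - by move=> r; exact/measurable_EFinP/measurableT_comp.
  - by move=> r x _; rewrite EFinM nnfun_muleindic_ge0.
under [RHS]eq_integral.
  move=> x xD; rewrite fimfunE -fsumEFin// ge0_mule_fsuml; last first.
    by move=> r; rewrite EFinM nnfun_muleindic_ge0.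
  over.
rewrite [RHS]ge0_integral_fsum//; last 2 first.
  - move=> r; apply: emeasurable_funM; last exact/measurable_EFinP.
    by apply/measurable_EFinP; apply/measurableT_comp.
  - move=> r x _; apply: mule_ge0; last by rewrite lee_fin.
    by rewrite EFinM nnfun_muleindic_ge0.
apply: eq_fsbigr => r _; rewrite integralZl_indic_nnsfun//= integral_indic//= setIT.
have mA : measurable (f_ n @^-1` [set r]) by exact: measurable_funPTI.
rewrite nuE//.
have [r0|r0] := ltP r 0%R.
  rewrite preimage_nnfun0// integral_set0 mule0 integral0_eq// => x _.
  by rewrite indic0 mulr0 mul0e.
rewrite -ge0_integralZl//; last 2 first.
  - by apply: measurable_funTS; exact/measurable_EFinP.
  - by move=> x _; rewrite lee_fin.
rewrite integral_mkcond; apply: eq_integral => x _.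
rewrite patchE indicE; case: ifPn => _; first by rewrite mulr1.
by rewrite mulr0 mul0e.
Qed.

End density.

Lemma ge0_integral_normal_law {d} {T : measurableType d} {R : realType}
    (P : probability T R) (Z : T -> R) (m s : R) (f : R -> \bar R) :
  measurable_fun setT Z ->
  (forall A, measurable A -> P (Z @^-1` A) = normal_prob m s A) ->
  measurable_fun setT f -> (forall x, 0 <= f x)%E ->
  (\int[P]_x f (Z x) =
   \int[@lebesgue_measure R]_x (f x * (normal_pdf m s x)%:E))%E.
Proof.
move=> mZ law mf f0.
have mZ' : measurable_fun setT (Z : T -> measurableTypeR R) by exact: mZ.
(* measurableTypeR R and R carry the same measurable sets under distinct
   displays; the Lebesgue measure lives on the former *)
pose Zm : {mfun T >-> measurableTypeR R} :=
  HB.pack (Z : T -> measurableTypeR R) (isMeasurableFun.Build _ _ _ _ _ mZ').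
rewrite -[LHS](ge0_integral_distribution (P := P) Zm mf f0).
apply: (ge0_integral_density _ (distribution P Zm)) => //.
- exact: measurable_normal_pdf.
- by move=> x; exact: normal_pdf_ge0.
Qed.

Lemma integral_normal_law {d} {T : measurableType d} {R : realType}
    (P : probability T R) (Z : T -> R) (m s A B : R) (h : R -> R) :
  s != 0 -> measurable_fun setT Z ->
  (forall A, measurable A -> P (Z @^-1` A) = normal_prob m s A) ->
  measurable_fun setT h -> (forall x, `|h x| <= A + B * (x - m) ^+ 2) ->
  P.-integrable setT (EFin \o (h \o Z)) /\
  \int[P]_x h (Z x) = \int[@lebesgue_measure R]_x (h x * normal_pdf m s x).
Proof.
move=> s0 mZ law mh hb.
have ihp := @integrable_mul_normal_pdf R m s A B h s0 mh hb.
have mhZ : measurable_fun setT (EFin \o (h \o Z)).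
  by apply/measurable_EFinP; exact: measurableT_comp.
split.
  apply/integrableP; split => //.
  rewrite (@ge0_integral_normal_law _ _ _ P Z m s (fun x => (`|h x|)%:E))//.
    have [_] := integrableP _ _ _ ihp; apply: le_lt_trans.
    rewrite le_eqVlt; apply/orP; left; apply/eqP; apply: eq_integral => x _.
    by rewrite /= normrM (ger0_norm (normal_pdf_ge0 _ _ _)).
  by apply/measurable_EFinP; apply: measurableT_comp.
rewrite /Rintegral; congr fine; rewrite integralE [RHS]integralE.
congr (_ - _)%E.
  transitivity (\int[P]_x (funepos (EFin \o h)) (Z x))%E.
    by apply: eq_integral => x _; rewrite !funeposE.
  rewrite (@ge0_integral_normal_law _ _ _ P Z m s)//; last first.
    by apply: measurable_funepos; exact/measurable_EFinP.
  apply: eq_integral => x _; rewrite !funeposE/= -!EFin_max -EFinM.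
  by rewrite maxr_pMl ?normal_pdf_ge0// mul0r.
transitivity (\int[P]_x (funeneg (EFin \o h)) (Z x))%E.
  by apply: eq_integral => x _; rewrite !funenegE.
rewrite (@ge0_integral_normal_law _ _ _ P Z m s)//; last first.
  by apply: measurable_funeneg; exact/measurable_EFinP.
apply: eq_integral => x _; rewrite !funenegE/= -!EFin_max -EFinM.
by rewrite maxr_pMl ?normal_pdf_ge0// mul0r mulNr.
Qed.

(** The degenerate counterpart of [integral_normal_law]. *)
Lemma integral_dirac_law {d} {T : measurableType d} {R : realType}
    (P : probability T R) (Z : T -> R) (m : R) (h : R -> R) :
  measurable_fun setT Z ->
  (forall A, measurable A -> P (Z @^-1` A) = \d_m A) ->
  measurable_fun setT h ->
  P.-integrable setT (EFin \o (h \o Z)) /\ \int[P]_x h (Z x) = h m.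
Proof.
move=> mZ law mh.
have Zm : {ae P, forall x, Z x = m}.
  exists (Z @^-1` (~` [set m])); split.
  - by rewrite -[X in measurable X]setTI; apply: mZ => //; exact: measurableC.
  - rewrite law; last exact: measurableC.
    by rewrite diracE memNset//= => /(_ erefl).
  - by move=> x /=.
have hZ (f : R -> \bar R) : measurable_fun setT f ->
    (\int[P]_x f (Z x) = f m)%E.
  move=> mf; transitivity (\int[P]_x (cst (f m) x))%E; last first.
    by rewrite integral_cst//= probability_setT mule1.
  apply: ae_eq_integral => //; first exact: measurableT_comp.
  by apply: filterS Zm => x -> _.
split; last by rewrite /Rintegral (hZ (EFin \o h))//; exact/measurable_EFinP.
apply/integrableP; split; first by apply/measurable_EFinP; exact: measurableT_comp.
rewrite (hZ (fun x => `|(h x)%:E|%E)) ?ltry//.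
by apply: measurableT_comp => //; exact/measurable_EFinP.
Qed.

Lemma gaussian_rv_integrable {d} {T : measurableType d} {R : realType}
    (P : probability T R) (Z : T -> R) :
  measurable_fun setT Z -> gaussian_rv P Z ->
  P.-integrable setT (EFin \o Z) /\
  P.-integrable setT (EFin \o (fun x => Z x ^+ 2)).
Proof.
move=> mZ [m [s [s0 law]]].
have mid : measurable_fun setT (id : R -> R) by exact: measurable_id.
have msq : measurable_fun setT (fun x : R => x ^+ 2) by exact: measurable_funX.
rewrite /gaussian_law in law; have [s0'|sn0] := eqVneq s 0.
  rewrite s0' eqxx in law.
  split; first exact: (integral_dirac_law _ _ _ _ mZ law mid).1.
  exact: (integral_dirac_law _ _ _ _ mZ law msq).1.
rewrite (negbTE sn0) in law; split.
  apply: (integral_normal_law _ _ _ _ (1 + `|m|) 1 _ sn0 mZ law mid _).1.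
  move=> x; have : `|x| <= `|x - m| + `|m|.
    by rewrite -[x in `|x| <= _](subrK m) ler_normD.
  rewrite -[(x - m) ^+ 2]real_normK ?num_real//.
  have := normr_ge0 (x - m); have := sqr_ge0 (`|x - m| - 1); nra.
apply: (integral_normal_law _ _ _ _ (2 * m ^+ 2) 2 _ sn0 mZ law msq _).1.
move=> x; rewrite ger0_norm ?sqr_ge0//.
by have := sqr_ge0 (x - m - m); nra.
Qed.

(** Everything that is needed from a one-dimensional Gaussian law. All the
    formulas persist for s = 0, so that later on the degenerate combinations are
    not singled out. *)
Lemma centered_gaussian_rv {d} {T : measurableType d} {R : realType}
    (P : probability T R) (Z : T -> R) :
  measurable_fun setT Z -> gaussian_rv P Z -> \int[P]_x Z x = 0 ->
  exists s : R, [/\ 0 <= s,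
    forall A, measurable A -> P (Z @^-1` A) = gaussian_law 0 s A,
    \int[P]_x (Z x ^+ 2) = s ^+ 2 &
    forall g, \int[P]_x cos (Z x + g) = expR (- (s ^+ 2 / 2)) * cos g].
Proof.
move=> mZ gZ EZ; have [m [s [s0 law]]] := gZ.
have mid : measurable_fun setT (id : R -> R) by exact: measurable_id.
have msq (c : R) : measurable_fun setT (fun x : R => (x - c) ^+ 2).
  by apply: measurable_funX; exact: measurable_funB.
have mcos g : measurable_fun setT (fun x : R => cos (x + g)).
  apply: continuous_measurable_fun => x.
  apply: (@continuous_comp _ _ _ (fun x => x + g)); last exact: continuous_cos.
  by apply: (@cvgD _ R^o); [exact: cvg_id|exact: cvg_cst].
have m0 : m = 0.
  rewrite /gaussian_law in law; have [s0'|sn0] := eqVneq s 0.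
    rewrite s0' eqxx in law.
    by have [_] := integral_dirac_law _ _ _ _ mZ law mid; rewrite EZ.
  rewrite (negbTE sn0) in law.
  have mB : measurable_fun setT (fun x : R => x - m) by exact: measurable_funB.
  have [] := integral_normal_law _ _ _ _ 1 1 _ sn0 mZ law mB _.
    move=> x; rewrite mul1r -[in leRHS]real_normK ?num_real//.
    by have := normr_ge0 (x - m); have := sqr_ge0 (`|x - m| - 1); nra.
  move=> _; rewrite normal_pdf_mean// RintegralB//; last 2 first.
  - exact: (gaussian_rv_integrable _ _ mZ gZ).1.
  - exact: finite_measure_integrable_cst.
  rewrite EZ Rintegral_cst//= probability_setT/= mulr1 => /eqP.
  by rewrite sub0r oppr_eq0 => /eqP.
rewrite m0 in law; exists s; split => //.
  rewrite /gaussian_law in law; have [s0'|sn0] := eqVneq s 0.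
    rewrite s0' eqxx in law; have [_] := integral_dirac_law _ _ _ _ mZ law (msq 0).
    by under eq_Rintegral do rewrite subr0; rewrite s0' subr0.
  rewrite (negbTE sn0) in law.
  have [] := integral_normal_law _ _ _ _ 0 1 _ sn0 mZ law (msq 0) _.
    by move=> x; rewrite ger0_norm ?sqr_ge0// add0r mul1r.
  move=> _; rewrite normal_pdf_moment2// => <-.
  by apply: eq_Rintegral => x _; rewrite subr0.
move=> g; rewrite /gaussian_law in law; have [s0'|sn0] := eqVneq s 0.
  rewrite s0' eqxx in law; have [_ ->] := integral_dirac_law _ _ _ _ mZ law (mcos g).
  by rewrite s0' expr0n/= mul0r oppr0 expR0 mul1r add0r.
rewrite (negbTE sn0) in law.
have [x|_ ->] := integral_normal_law _ _ _ _ 1 0 _ sn0 mZ law (mcos g).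
  by rewrite mul0r addr0 ler_norml cos_geN1 cos_le1.
by rewrite normal_pdf_cos.
Qed.

(** * Bounded pointwise limits of cosines *)

Section pointwise_limits.
Context {T : Type} {R : realType}.
Implicit Types (f g : T -> R) (V K : set (T -> R)).

(** Bounded pointwise limits are those through which the expectation passes, by
    dominated convergence. *)
Inductive bounded_closure V : (T -> R) -> Prop :=
| bounded_closure_base f : V f -> bounded_closure V f
| bounded_closure_lim (u : nat -> T -> R) f (M : R) :
    (forall n, bounded_closure V (u n)) -> (forall n x, `|u n x| <= M) ->
    (forall x, u n x @[n --> \oo] --> f x) -> bounded_closure V f.

Inductive cos_span K : (T -> R) -> Prop :=
| cos_span_cos z : K z -> cos_span K (fun x => cos (z x))
| cos_span_add f g : cos_span K f -> cos_span K g -> cos_span K (fun x => f x + g x)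
| cos_span_scale c f : cos_span K f -> cos_span K (fun x => c * f x).

Definition fbounded f := exists M : R, forall x, `|f x| <= M.

Lemma cvg_le_bound (u : nat -> T -> R) f (M : R) :
  (forall n x, `|u n x| <= M) -> (forall x, u n x @[n --> \oo] --> f x) ->
  forall x, `|f x| <= M.
Proof.
move=> uM uf x.
have cvn : `|u n x| @[n --> \oo] --> `|f x| by apply: cvg_norm; exact: uf.
rewrite -(cvg_lim _ cvn)//; apply: limr_le.
  by apply/cvg_ex; eexists; exact: cvn.
by apply: nearW => n; exact: uM.
Qed.

Lemma bounded_closure_bounded V : (forall f, V f -> fbounded f) ->
  forall f, bounded_closure V f -> fbounded f.
Proof.
move=> Vb f; elim=> [{}f /Vb//|u {}f M _ _ uM uf]; exists M.
exact: cvg_le_bound uM uf.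
Qed.

(** Limits are taken in one argument at a time: the other one is bounded, which
    keeps the bound uniform along the sequence. *)
Lemma bounded_closure_op2 (op : R -> R -> R) V :
  (forall M N, exists B, forall a b, `|a| <= M -> `|b| <= N -> `|op a b| <= B) ->
  (forall (a : nat -> R) a' b, a n @[n --> \oo] --> a' ->
     op (a n) b @[n --> \oo] --> op a' b) ->
  (forall (a : nat -> R) a' b, a n @[n --> \oo] --> a' ->
     op b (a n) @[n --> \oo] --> op b a') ->
  (forall f, V f -> fbounded f) ->
  (forall f g, V f -> V g -> V (fun x => op (f x) (g x))) ->
  forall f g, bounded_closure V f -> bounded_closure V g ->
    bounded_closure V (fun x => op (f x) (g x)).
Proof.
move=> opb opl opr Vb Vop f g Cf Cg.
elim: Cf => [{}f Vf|u {}f M Cu IH uM uf].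
  elim: Cg => [{}g Vg|u {}g M Cu IH uM uf].
    by apply: bounded_closure_base; exact: Vop.
  have [N fN] := Vb _ Vf; have [B opB] := opb N M.
  apply: (@bounded_closure_lim _ (fun n x => op (f x) (u n x)) _ B) => //.
    by move=> n x; exact: opB.
  by move=> x; apply: opr; exact: uf.
have [N gN] := bounded_closure_bounded _ Vb _ Cg; have [B opB] := opb M N.
apply: (@bounded_closure_lim _ (fun n x => op (u n x) (g x)) _ B) => //.
  by move=> n x; exact: opB.
by move=> x; apply: opl; exact: uf.
Qed.

Lemma cos_span_bounded K f : cos_span K f -> fbounded f.
Proof.
elim=> [z _|{}f g _ [M fM] _ [N gN]|c {}f _ [M fM]].
- by exists 1 => x; rewrite ler_norml cos_geN1 cos_le1.
- by exists (M + N) => x; rewrite (le_trans (ler_normD _ _))// lerD.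
- by exists (`|c| * M) => x; rewrite normrM ler_wpM2l.
Qed.

(** Product-to-sum formula: this is what makes the span of the cosines an
    algebra. *)
Lemma cos_span_mul K : (forall z w, K z -> K w -> K (fun x => z x + w x)) ->
  (forall z w, K z -> K w -> K (fun x => z x - w x)) ->
  forall f g, cos_span K f -> cos_span K g -> cos_span K (fun x => f x * g x).
Proof.
move=> KD KB f g Hf Hg.
elim: Hf => [z Kz|f1 f2 _ I1 _ I2|c {}f _ IH]; last 2 first.
- rewrite (_ : (fun _ => _) = fun x => f1 x * g x + f2 x * g x).
    exact: cos_span_add.
  by apply/funext => x; rewrite mulrDl.
- rewrite (_ : (fun _ => _) = fun x => c * (f x * g x)).
    exact: cos_span_scale.
  by apply/funext => x; rewrite mulrA.
elim: Hg => [w Kw|f1 f2 _ I1 _ I2|c {}f _ IH]; last 2 first.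
- rewrite (_ : (fun _ => _) = fun x => cos (z x) * f1 x + cos (z x) * f2 x).
    exact: cos_span_add.
  by apply/funext => x; rewrite mulrDr.
- rewrite (_ : (fun _ => _) = fun x => c * (cos (z x) * f x)).
    exact: cos_span_scale.
  by apply/funext => x; rewrite mulrCA.
rewrite (_ : (fun _ => _) =
    fun x => 2^-1 * cos (z x + w x) + 2^-1 * cos (z x - w x)).
  apply: cos_span_add; apply: cos_span_scale; apply: cos_span_cos;
    [exact: KD|exact: KB].
by apply/funext => x; rewrite cosD cosB; field.
Qed.

End pointwise_limits.

Section sign_iteration.
Context {R : realType}.

(** A polynomial mapping [-1, 1] to itself, with fixed points -1, 0 and 1, of
    which 0 is repelling: its iterates approximate the sign. *)
Definition sign_step (s : R) := (3 * s - s ^+ 3) / 2.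

Lemma sign_step_bound (s : R) : `|s| <= 1 -> `|sign_step s| <= 1.
Proof.
rewrite !ler_norml /sign_step => /andP[s1 s2]; apply/andP; split.
  have : 0 <= (s + 1) ^+ 2 * (2 - s) by rewrite mulr_ge0 ?sqr_ge0//; lra.
  by move=> h; nra.
have : 0 <= (s - 1) ^+ 2 * (2 + s) by rewrite mulr_ge0 ?sqr_ge0//; lra.
by move=> h; nra.
Qed.

Lemma iter_sign_step_bound (s : R) n : `|s| <= 1 -> `|iter n sign_step s| <= 1.
Proof. by move=> s1; elim: n => //= n IH; exact: sign_step_bound. Qed.

Lemma sign_step_opp (s : R) : sign_step (- s) = - sign_step s.
Proof. by rewrite /sign_step; field. Qed.

Lemma iter_sign_step_opp (s : R) n :
  iter n sign_step (- s) = - iter n sign_step s.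
Proof. by elim: n => //= n ->; exact: sign_step_opp. Qed.

(** For 0 < s <= 1 the iterates increase and their distance to 1 is multiplied
    by (1 - t) (2 + t) / 2 <= 1 - s / 2 at a point t >= s; negative s follow by
    oddness. *)
Lemma cvg_iter_sign_step (s : R) : `|s| <= 1 ->
  iter n sign_step s @[n --> \oo] --> Num.sg s.
Proof.
wlog s0 : s / 0 <= s => [hw|].
  move=> s1; have [s0|s0] := leP 0 s; first exact: hw.
  have := hw (- s); rewrite oppr_ge0 normrN sgrN => /(_ (ltW s0) s1) h.
  have -> : (fun n => iter n sign_step s) = (fun n => - iter n sign_step (- s)).
    by apply/funext => n; rewrite iter_sign_step_opp opprK.
  by rewrite -[Num.sg s]opprK; apply: (@cvgN _ R^o).
rewrite ger0_norm// => s1.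
have [->|sn0] := eqVneq s 0.
  rewrite sgr0; have -> : (fun n => iter n sign_step 0) = (fun=> 0).
    by apply/funext; elim=> //= n ->; rewrite /sign_step expr0n/= mulr0 subr0 mul0r.
  exact: (@cvg_cst R^o).
have sp : 0 < s by rewrite lt_neqAle eq_sym sn0.
rewrite gtr0_sg//.
(* monotonicity keeps the iterates above s, whence the fixed ratio *)
have key n : s <= iter n sign_step s <= 1 /\
    1 - iter n sign_step s <= (1 - s / 2) ^+ n.
  elim: n => [|n [/andP[h1 h2] h3]] /=.
    by rewrite expr0 lexx s1 gerBl.
  set t := iter n sign_step s in h1 h2 h3 *.
  have e1 : sign_step t - t = t * (1 - t) * (1 + t) / 2 by rewrite /sign_step; field.
  have e2 : 1 - sign_step t = (1 - t) * ((1 - t) * (2 + t) / 2).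
    by rewrite /sign_step; field.
  have b1 : 0 <= sign_step t - t.
    by rewrite e1 !mulr_ge0//; lra.
  have b2 : 0 <= 1 - sign_step t.
    by rewrite e2 !mulr_ge0//; lra.
  split; first by apply/andP; split; lra.
  rewrite e2 exprSr; apply: ler_pM => //; [lra| |].
    by rewrite !mulr_ge0//; lra.
  by nra.
apply: (@squeeze_cvgr _ _ _ _ (fun n => 1 - (1 - s / 2) ^+ n) (cst 1)).
- by apply: nearW => n /=; have [/andP[_ ->] h] := key n; rewrite andbT; lra.
- rewrite -[X in _ --> X]subr0; apply: (@cvgB _ R^o); first exact: cvg_cst.
  by apply: cvg_expr; rewrite ger0_norm; lra.
- exact: (@cvg_cst R^o).
Qed.

End sign_iteration.

(** Constants belong to the family, so that the phases of the cosines and the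
    levels of the half-spaces need no separate parameter. *)
Definition affine_closed {T : Type} {R : realType} (K : set (T -> R)) :=
  [/\ forall c, K (fun=> c),
      forall z w, K z -> K w -> K (fun x => z x + w x) &
      forall c z, K z -> K (fun x => c * z x)].

Section sigma_algebra_of_cos.
Context {T : Type} {R : realType} {K : set (T -> R)}.
Hypothesis hK : affine_closed K.
Local Notation C := (bounded_closure (cos_span K)).

Let Kc : forall c, K (fun=> c). Proof. by have [] := hK. Qed.
Let KD : forall z w, K z -> K w -> K (fun x => z x + w x).
Proof. by have [] := hK. Qed.
Let KZ : forall c z, K z -> K (fun x => c * z x). Proof. by have [] := hK. Qed.
Let KB z w : K z -> K w -> K (fun x => z x - w x).
Proof.
move=> Kz Kw; have -> : (fun x => z x - w x) = (fun x => z x + (-1) * w x).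
  by apply/funext => x; rewrite mulN1r.
by apply: KD => //; exact: KZ.
Qed.

Lemma bounded_closure_cos_cst c : C (fun=> c).
Proof.
apply: bounded_closure_base; rewrite (_ : (fun=> c) = fun=> c * cos 0).
  by apply: cos_span_scale; apply: (@cos_span_cos _ _ K (fun=> 0)); exact: Kc.
by apply/funext => x; rewrite cos0 mulr1.
Qed.

Lemma bounded_closure_cosD f g : C f -> C g -> C (fun x => f x + g x).
Proof.
apply: (@bounded_closure_op2 _ _ (fun a b => a + b)).
- move=> M N; exists (M + N) => a b aM bN.
  by rewrite (le_trans (ler_normD _ _))// lerD.
- by move=> a a' b aa'; apply: (@cvgD _ R^o) => //; exact: cvg_cst.
- by move=> a a' b aa'; apply: (@cvgD _ R^o) => //; exact: cvg_cst.
- exact: cos_span_bounded.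
- exact: cos_span_add.
Qed.

Lemma bounded_closure_cosM f g : C f -> C g -> C (fun x => f x * g x).
Proof.
apply: (@bounded_closure_op2 _ _ (fun a b => a * b)).
- by move=> M N; exists (M * N) => a b aM bN; rewrite normrM ler_pM.
- by move=> a a' b aa'; apply: cvgM => //; exact: cvg_cst.
- by move=> a a' b aa'; apply: cvgM => //; exact: cvg_cst.
- exact: cos_span_bounded.
- exact: cos_span_mul.
Qed.

Lemma bounded_closure_cos_sg f : C f -> (forall x, `|f x| <= 1) ->
  C (fun x => Num.sg (f x)).
Proof.
move=> Cf f1; apply: (@bounded_closure_lim _ _ _ (fun n x => iter n sign_step (f x)) _ 1).
- elim=> [//|n IH] /=.
  have -> : (fun x => sign_step (iter n sign_step (f x))) =
      (fun x => (3 / 2) * iter n sign_step (f x) +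
       (- 2^-1) * (iter n sign_step (f x) *
         (iter n sign_step (f x) * iter n sign_step (f x)))).
    by apply/funext => x; rewrite /sign_step; field.
  apply: bounded_closure_cosD; apply: bounded_closure_cosM => //;
    try exact: bounded_closure_cos_cst.
  by do 2!apply: bounded_closure_cosM => //.
- by move=> n x; exact: iter_sign_step_bound.
- by move=> x; exact: cvg_iter_sign_step.
Qed.

(** sin (z / n) is a cosine of the family and has the sign of z as soon as
    |z| < n pi. *)
Lemma bounded_closure_cos_sg_rv z : K z -> C (fun x => Num.sg (z x)).
Proof.
move=> Kz.
apply: (@bounded_closure_lim _ _ _ (fun n x => Num.sg (sin (n.+1%:R^-1 * z x))) _ 1).
- move=> n; apply: bounded_closure_cos_sg; last first.
    by move=> x; rewrite ler_norml sin_geN1 sin_le1.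
  apply: bounded_closure_base.
  rewrite (_ : (fun x => _) = fun x => cos (n.+1%:R^-1 * z x - pi / 2)).
    apply: (@cos_span_cos _ _ K (fun x => n.+1%:R^-1 * z x - pi / 2)).
    by apply: KB; [exact: KZ|exact: Kc].
  by apply/funext => x; rewrite cosB cos_pihalf sin_pihalf mulr0 add0r mulr1.
- by move=> n x; rewrite normr_sg; case: eqP.
- move=> x; apply: cvg_near_cst; near=> n.
  have zn : `|z x| < n.+1%:R * pi.
    have pi1 : 1 <= pi :> R by have := @pi_ge2 R; lra.
    have : `|z x| < n.+1%:R.
      rewrite -natr1; have : `|z x| <= n%:R by near: n; exact: nbhs_infty_ger.
      by lra.
    by move=> /lt_le_trans; apply; rewrite ler_peMr.
  have n0 : (0 : R) < n.+1%:R by [].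
  have [z0|z0|->] := ltgtP (z x) 0; last by rewrite mulr0 sin0.
    rewrite (ltr0_sg z0) ltr0_sg// -oppr_gt0 -sinN sin_gt0_pi//.
    rewrite -mulrN mulr_gt0 ?invr_gt0 ?oppr_gt0//=.
    by rewrite ltr_pdivrMl// -(ltr0_norm z0).
  rewrite (gtr0_sg z0) gtr0_sg// sin_gt0_pi// mulr_gt0 ?invr_gt0//=.
  by rewrite ltr_pdivrMl// -(gtr0_norm z0).
Unshelve. all: by end_near. Qed.

Definition rv_halfspaces : set (set T) :=
  [set A | exists2 z, K z & A = [set x | 0 < z x]].

Lemma bounded_closure_cos_halfspace z : K z -> C (\1_[set x | 0 < z x]).
Proof.
move=> Kz; have Cs := bounded_closure_cos_sg_rv _ Kz.
rewrite (_ : \1_ _ = fun x =>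
  2^-1 * (Num.sg (z x) + Num.sg (z x) * Num.sg (z x))).
  apply: bounded_closure_cosM; first exact: bounded_closure_cos_cst.
  by apply: bounded_closure_cosD => //; exact: bounded_closure_cosM.
apply/funext => x; rewrite indicE; have [z0|z0|z0] := ltgtP (z x) 0.
- by rewrite memNset ?ltr0_sg//=; [lra|rewrite ltNge (ltW z0)].
- by rewrite mem_set ?gtr0_sg//=; lra.
- by rewrite memNset/= ?z0 ?ltxx// sgr0; lra.
Qed.

(** The events whose indicator is a limit of cosines form a sigma-algebra: the
    indicator of a countable union is the limit of
    1 - \prod_(i < n) (1 - \1_(A i)). *)
Lemma bounded_closure_cos_sigma_algebra A : <<s rv_halfspaces >> A -> C (\1_A).
Proof.
move: A; apply: (@smallest_sub _ _ _ [set A | C (\1_A)]); last first.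
  by move=> A [z Kz ->]; exact: bounded_closure_cos_halfspace.
have CC A : C (\1_A) -> C (fun x => 1 - (\1_A x)).
  move=> CA; rewrite (_ : (fun x => _) = fun x => 1 + (-1) * (\1_A x)).
    apply: bounded_closure_cosD; first exact: bounded_closure_cos_cst.
    by apply: bounded_closure_cosM => //; exact: bounded_closure_cos_cst.
  by apply/funext => x; rewrite mulN1r.
split.
- by rewrite /= indic0; exact: bounded_closure_cos_cst.
- move=> A /= /CC; congr C; apply/funext => x.
  by rewrite setTD !indicE in_setC; case: (_ \in _); rewrite /= ?subr0 ?subrr.
- move=> A /= CA.
  pose p n x : R := \prod_(i < n) (1 - \1_(A i) x).
  have p01 n x : 0 <= p n x <= 1.
    apply/andP; split.
      by apply: prodr_ge0 => i _; rewrite indicE; case: (_ \in _) => /=; lra.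
    apply: prodr_ile1 => i _; rewrite indicE.
    by case: (_ \in _) => /=; apply/andP; split; lra.
  apply: (@bounded_closure_lim _ _ _ (fun n x => 1 - p n x) _ 1).
  + move=> n; rewrite (_ : (fun x => _) = fun x => 1 + (-1) * p n x); last first.
      by apply/funext => x; rewrite mulN1r.
    apply: bounded_closure_cosD; first exact: bounded_closure_cos_cst.
    apply: bounded_closure_cosM; first exact: bounded_closure_cos_cst.
    elim: n => [|n IH].
      rewrite (_ : p 0%N = fun=> 1); first exact: bounded_closure_cos_cst.
      by apply/funext => x; rewrite /p big_ord0.
    rewrite (_ : p n.+1 = fun x => p n x * (1 - \1_(A n) x)).
      by apply: bounded_closure_cosM => //; exact: CC.
    by apply/funext => x; rewrite /p big_ord_recr.
  + by move=> n x; have /andP[? ?] := p01 n x; rewrite ler_norml; apply/andP; split; lra.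
  + move=> x; rewrite indicE; have [/set_mem[k _ Akx]|nA] := boolP (x \in \bigcup_k A k).
      apply: cvg_near_cst; near=> n.
      have kn : (k < n)%N by near: n; exact: nbhs_infty_gt.
      rewrite /p (bigD1 (Ordinal kn))//= indicE mem_set// subrr mul0r subr0//.
    apply: cvg_near_cst; apply: nearW => n.
    rewrite /p big1 ?subrr// => i _; rewrite indicE memNset ?subr0// => Aix.
    by move/negP: nA; apply; apply/mem_set; exists i.
Unshelve. all: by end_near. Qed.

End sigma_algebra_of_cos.

(** * Independence from the factorization of cosines *)

Section independence.
Context {d} {T : measurableType d} {R : realType} (P : probability T R).
Implicit Types (f g z w : T -> R) (K L : set (T -> R)).

Lemma integrable_bounded f : measurable_fun setT f -> fbounded f ->
  P.-integrable setT (EFin \o f).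
Proof.
move=> mf [M fM].
have iM : P.-integrable setT (EFin \o (fun=> M : R)).
  exact: finite_measure_integrable_cst.
apply: le_integrable iM => //; first exact/measurable_EFinP.
by move=> x _; rewrite /= lee_fin (le_trans (fM x))// ler_norm.
Qed.

Lemma cvg_Rintegral_bounded (u : nat -> T -> R) f (M : R) :
  (forall n, measurable_fun setT (u n)) -> (forall n x, `|u n x| <= M) ->
  (forall x, u n x @[n --> \oo] --> f x) ->
  \int[P]_x u n x @[n --> \oo] --> \int[P]_x f x.
Proof.
move=> mu uM uf.
have mf : measurable_fun setT f by apply: measurable_fun_cvg mu _ => x _; exact: uf.
have fM : fbounded f by exists M; exact: cvg_le_bound uM uf.
have iM : P.-integrable setT (EFin \o (fun=> M : R)).
  exact: finite_measure_integrable_cst.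
apply: fine_cvg; rewrite /Rintegral fineK; last first.
  by apply: integrable_fin_num => //; exact: integrable_bounded.
apply: (@dominated_cvg _ _ _ P _ measurableT _ _ (EFin \o (fun=> M : R))) => //.
- by move=> n; exact/measurable_EFinP.
- by move=> x _; apply: cvg_EFin; [exact: nearW|exact: uf].
- by move=> n x _; rewrite /= lee_fin.
Qed.

Lemma bounded_closure_cos_measurable K f : (forall z, K z -> measurable_fun setT z) ->
  bounded_closure (cos_span K) f -> measurable_fun setT f.
Proof.
move=> mK; elim=> [{}f|u {}f M _ mu _ uf]; last first.
  by apply: measurable_fun_cvg mu _ => x _; exact: uf.
elim=> [z Kz|{}f g _ mf _ mg|c {}f _ mf].
- apply: measurableT_comp; last exact: mK.
  by apply: continuous_measurable_fun; exact: continuous_cos.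
- exact: measurable_funD.
- exact: measurable_funM.
Qed.

(** For a fixed g the identity is linear in f and passes to bounded limits. *)
Lemma bounded_closure_cos_factor K g : (forall z, K z -> measurable_fun setT z) ->
  measurable_fun setT g -> fbounded g ->
  (forall z, K z -> \int[P]_x (cos (z x) * g x) =
                    \int[P]_x cos (z x) * \int[P]_x g x) ->
  forall f, bounded_closure (cos_span K) f ->
  \int[P]_x (f x * g x) = \int[P]_x f x * \int[P]_x g x.
Proof.
move=> mK mg bg Kg f.
have mS h : cos_span K h -> measurable_fun setT h.
  by move=> Kh; apply: (bounded_closure_cos_measurable K) => //; exact: bounded_closure_base.
have iS h : cos_span K h -> P.-integrable setT (EFin \o h).
  move=> Kh; apply: integrable_bounded; first exact: mS.
  exact: cos_span_bounded Kh.
have iSg h : cos_span K h -> P.-integrable setT (EFin \o (fun x => h x * g x)).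
  move=> Kh; apply: integrable_bounded.
    by apply: measurable_funM => //; exact: mS.
  have [M hM] := cos_span_bounded _ _ Kh; have [N gN] := bg.
  by exists (M * N) => x; rewrite normrM ler_pM.
elim=> [{}f|u {}f M Cu IH uM uf].
  elim=> [z Kz|f1 f2 K1 I1 K2 I2|c {}f Kf IH]; first exact: Kg.
  - under eq_Rintegral do rewrite mulrDl.
    rewrite (RintegralD measurableT (iSg _ K1) (iSg _ K2)) I1 I2.
    by rewrite (RintegralD measurableT (iS _ K1) (iS _ K2)) mulrDl.
  - under eq_Rintegral do rewrite -mulrA.
    rewrite (RintegralZl _ measurableT (iSg _ Kf)) IH.
    by rewrite (RintegralZl _ measurableT (iS _ Kf)) mulrA.
have [N gN] := bg.
have mu n : measurable_fun setT (u n) by exact: (bounded_closure_cos_measurable K).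
have c1 : \int[P]_x (u n x * g x) @[n --> \oo] --> \int[P]_x (f x * g x).
  apply: (@cvg_Rintegral_bounded (fun n x => u n x * g x) _ (M * N)).
  - by move=> n; exact: measurable_funM.
  - by move=> n x; rewrite normrM ler_pM.
  - by move=> x; apply: cvgM; [exact: uf|exact: cvg_cst].
have c2 : \int[P]_x (u n x * g x) @[n --> \oo] -->
    \int[P]_x f x * \int[P]_x g x.
  under eq_fun do rewrite IH.
  by apply: cvgM; [exact: (@cvg_Rintegral_bounded u f M)|exact: cvg_cst].
by rewrite -(cvg_lim _ c1)// -(cvg_lim _ c2).
Qed.

Lemma Rintegral_indic_prob (A : set T) : measurable A ->
  \int[P]_x \1_A x = fine (P A).
Proof. by move=> mA; rewrite /Rintegral integral_indic// setIT. Qed.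

(** The factorization is extended from cosines to indicators in two passes:
    first in the K-argument, against a fixed cosine of L, then in the
    L-argument, against the indicator of A. *)
Lemma independent_of_cos K L A B : affine_closed K -> affine_closed L ->
  (forall z, K z -> measurable_fun setT z) ->
  (forall w, L w -> measurable_fun setT w) ->
  (forall z w, K z -> L w -> \int[P]_x (cos (z x) * cos (w x)) =
                    \int[P]_x cos (z x) * \int[P]_x cos (w x)) ->
  <<s @rv_halfspaces _ _ K >> A -> <<s @rv_halfspaces _ _ L >> B ->
  (P (A `&` B) = P A * P B)%E.
Proof.
move=> hK hL mK mL KL sA sB.
have cA := bounded_closure_cos_sigma_algebra hK _ sA.
have cB := bounded_closure_cos_sigma_algebra hL _ sB.
have mh (Q : set (T -> R)) E : (forall z, Q z -> measurable_fun setT z) ->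
    <<s @rv_halfspaces _ _ Q >> E -> measurable E.
  move=> mQ; move: E; apply: smallest_sub; first exact: sigma_algebra_measurable.
  move=> E [z Qz ->]; rewrite -[X in measurable X]setTI.
  rewrite (_ : [set x | 0 < z x] = z @^-1` `]0, +oo[%classic).
    by apply: mQ => //; exact: measurable_itv.
  by apply/seteqP; split => x /=; rewrite in_itv/= andbT.
have mA := mh _ _ mK sA; have mB := mh _ _ mL sB.
have bi (E : set T) : fbounded (\1_E : T -> R).
  by exists 1 => x; rewrite indicE ger0_norm//; case: (_ \in _).
have step1 w : L w -> \int[P]_x (\1_A x * cos (w x)) =
    \int[P]_x \1_A x * \int[P]_x cos (w x).
  move=> Lw; apply: (@bounded_closure_cos_factor K) => //.
  - apply: measurableT_comp; last exact: mL.
    by apply: continuous_measurable_fun; exact: continuous_cos.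
  - by exists 1 => x; rewrite ler_norml cos_geN1 cos_le1.
  - by move=> z Kz; exact: KL.
have : \int[P]_x (\1_B x * \1_A x) = \int[P]_x \1_B x * \int[P]_x \1_A x.
  apply: (@bounded_closure_cos_factor L) => //.
  move=> w Lw; rewrite mulrC -step1//.
  by apply: eq_Rintegral => x _; rewrite mulrC.
have -> : (fun x => \1_B x * \1_A x) = \1_(A `&` B) :> (T -> R).
  by apply/funext => x; rewrite indicI mulrC.
rewrite !Rintegral_indic_prob//; last exact: measurableI.
move=> h; rewrite -(fineK (fin_num_measure P _ (measurableI _ _ mA mB))) h EFinM muleC.
by rewrite !fineK// fin_num_measure.
Qed.

End independence.

(** * Linear combinations of a centered Gaussian vector *)

Section gaussian_vectors.
Context {d} {T : measurableType d} {R : realType} (P : probability T R).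
Context {p : nat} (Y : 'I_p -> {RV P >-> R}).
Hypothesis hG : gaussian_vector Y.
Hypothesis hC : centered Y.
Implicit Types (a b : 'rV[R]_p).

Definition lincomb a (w : T) : R := \sum_(j < p) a ord0 j * Y j w.

Lemma lincombD a b w : lincomb (a + b) w = lincomb a w + lincomb b w.
Proof.
rewrite /lincomb -big_split/=; apply: eq_bigr => j _.
by rewrite mxE mulrDl.
Qed.

Lemma lincombZ c a w : lincomb (c *: a) w = c * lincomb a w.
Proof.
rewrite /lincomb big_distrr/=; apply: eq_bigr => j _.
by rewrite mxE mulrA.
Qed.

Lemma lincomb0 w : lincomb 0 w = 0.
Proof. by rewrite -(scale0r 0) lincombZ mul0r. Qed.

Lemma lincomb_delta j w : lincomb (delta_mx ord0 j) w = Y j w.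
Proof.
rewrite /lincomb (bigD1 j)//= mxE !eqxx mul1r big1 ?addr0// => k kj.
by rewrite mxE eqxx (negbTE kj) mul0r.
Qed.

Lemma measurable_lincomb a : measurable_fun setT (lincomb a).
Proof. by apply: measurable_sum => j; apply: measurable_funM. Qed.

Lemma integrable_lincomb a : P.-integrable setT (EFin \o lincomb a).
Proof. exact: (gaussian_rv_integrable _ _ (measurable_lincomb a) (hG a)).1. Qed.

Lemma integrable_lincomb_sqr a :
  P.-integrable setT (EFin \o (fun w => lincomb a w ^+ 2)).
Proof. exact: (gaussian_rv_integrable _ _ (measurable_lincomb a) (hG a)).2. Qed.

Lemma integrable_lincombM a b :
  P.-integrable setT (EFin \o (fun w => lincomb a w * lincomb b w)).
Proof.
have h : P.-integrable setT (fun w => (lincomb a w ^+ 2)%:E + (lincomb b w ^+ 2)%:E)%E.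
  by apply: integrableD => //; exact: integrable_lincomb_sqr.
apply: le_integrable h => //.
  by apply/measurable_EFinP; apply: measurable_funM; exact: measurable_lincomb.
move=> w _; rewrite /= lee_fin [leRHS]ger0_norm ?addr_ge0 ?sqr_ge0//.
set u := lincomb a w; set v := lincomb b w.
rewrite normrM -(real_normK (num_real u)) -(real_normK (num_real v)).
have := normr_ge0 u; have := normr_ge0 v.
by have := sqr_ge0 (`|u| - `|v|); nra.
Qed.

Lemma Rintegral_lincomb a : \int[P]_w lincomb a w = 0.
Proof.
rewrite (row_sum_delta a).
apply: (@big_ind _ (fun a => \int[P]_w lincomb a w = 0)).
- by under eq_Rintegral do rewrite lincomb0; rewrite Rintegral_cst// mul0r.
- move=> u v Hu Hv; under eq_Rintegral do rewrite lincombD.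
  rewrite (RintegralD measurableT (integrable_lincomb u) (integrable_lincomb v)).
  by rewrite Hu Hv addr0.
- move=> j _; under eq_Rintegral do rewrite lincombZ.
  rewrite (RintegralZl _ measurableT (integrable_lincomb _)).
  under eq_Rintegral do rewrite lincomb_delta.
  have := hC j; rewrite unlock /Rintegral => ->.
  by rewrite mulr0.
Qed.

(** The covariance of two combinations, which are centered. *)
Definition cov a b : R := \int[P]_w (lincomb a w * lincomb b w).

Lemma covC a b : cov a b = cov b a.
Proof. by apply: eq_Rintegral => w _; rewrite mulrC. Qed.

Lemma covDl a b c : cov (a + b) c = cov a c + cov b c.
Proof.
rewrite /cov; under eq_Rintegral do rewrite lincombD mulrDl.
by rewrite (RintegralD measurableT (integrable_lincombM a c) (integrable_lincombM b c)).
Qed.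

Lemma covZl k a c : cov (k *: a) c = k * cov a c.
Proof.
rewrite /cov; under eq_Rintegral do rewrite lincombZ -mulrA.
by rewrite (RintegralZl _ measurableT (integrable_lincombM a c)).
Qed.

Lemma covDr a b c : cov c (a + b) = cov c a + cov c b.
Proof. by rewrite !(covC c) covDl. Qed.

Lemma covZr k a c : cov c (k *: a) = k * cov c a.
Proof. by rewrite !(covC c) covZl. Qed.

Lemma cov_ge0 a : 0 <= cov a a.
Proof. by apply: Rintegral_ge0 => w _; rewrite -expr2 sqr_ge0. Qed.

(** The variance of (cov a a) b - (cov a b) a is nonnegative. *)
Lemma cov_cauchy_schwarz a b : 0 < cov a a -> cov a b ^+ 2 <= cov a a * cov b b.
Proof.
move=> a0; have := cov_ge0 (cov a a *: b + (- cov a b) *: a).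
rewrite !covDl !covDr !covZl !covZr (covC b a) => h.
have : 0 <= cov a a * (cov a a * cov b b - cov a b ^+ 2) by nra.
by rewrite pmulr_rge0// subr_ge0.
Qed.

Lemma gaussian_lincomb a : exists s : R, [/\ 0 <= s,
  forall A, measurable A -> P (lincomb a @^-1` A) = gaussian_law 0 s A &
  cov a a = s ^+ 2].
Proof.
have [s [s0 law v _]] := centered_gaussian_rv _ _ (measurable_lincomb a) (hG a)
  (Rintegral_lincomb a).
by exists s; split.
Qed.

Lemma Rintegral_cos_lincomb a g :
  \int[P]_w cos (lincomb a w + g) = expR (- (cov a a / 2)) * cos g.
Proof.
have [s [s0 _ v h]] := centered_gaussian_rv _ _ (measurable_lincomb a) (hG a)
  (Rintegral_lincomb a).
by rewrite h -v.
Qed.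

(** The product of cosines is half the sum of the cosines of the sum and of the
    difference, and uncorrelated variances add up in both. *)
Lemma Rintegral_cos_uncorrelated a b g h : cov a b = 0 ->
  \int[P]_w (cos (lincomb a w + g) * cos (lincomb b w + h)) =
  \int[P]_w cos (lincomb a w + g) * \int[P]_w cos (lincomb b w + h).
Proof.
move=> ab0; have ba0 : cov b a = 0 by rewrite covC.
have mc c k : measurable_fun setT (fun w => cos (lincomb c w + k)).
  apply: measurableT_comp; last first.
    by apply: measurable_funD => //; exact: measurable_lincomb.
  by apply: continuous_measurable_fun; exact: continuous_cos.
have ic c k : P.-integrable setT (EFin \o (fun w => cos (lincomb c w + k))).
  apply: integrable_bounded => //.
  by exists 1 => x; rewrite ler_norml cos_geN1 cos_le1.
have ich c k : P.-integrable setT (EFin \o (fun w => 2^-1 * cos (lincomb c w + k))).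
  by have := @integrableZl _ _ _ _ setT measurableT (2^-1 : R) _ (ic c k).
transitivity (\int[P]_w (2^-1 * cos (lincomb (a + b) w + (g + h)) +
    2^-1 * cos (lincomb (a + (-1) *: b) w + (g - h)))).
  apply: eq_Rintegral => w _; rewrite !lincombD lincombZ.
  rewrite (_ : lincomb a w + lincomb b w + (g + h) =
    (lincomb a w + g) + (lincomb b w + h)); last by ring.
  rewrite (_ : lincomb a w + -1 * lincomb b w + (g - h) =
    (lincomb a w + g) - (lincomb b w + h)); last by ring.
  move: (lincomb a w + g) (lincomb b w + h) => u v.
  by rewrite cosD cosB; field.
rewrite (RintegralD measurableT (ich _ _) (ich _ _)).
rewrite !(RintegralZl _ measurableT (ic _ _)) !Rintegral_cos_lincomb.
rewrite !covDl !covDr !covZl !covZr ab0 ba0.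
have e : expR (- (cov a a / 2)) * expR (- (cov b b / 2)) =
    expR (- ((cov a a + cov b b) / 2)) by rewrite -expRD; congr expR; field.
rewrite (_ : - ((cov a a + 0 + (0 + cov b b)) / 2) = - ((cov a a + cov b b) / 2));
  last by field.
rewrite (_ : - ((cov a a + -1 * 0 + (-1 * 0 + -1 * (-1 * cov b b))) / 2) =
  - ((cov a a + cov b b) / 2)); last by field.
by rewrite -e cosD cosB; field.
Qed.

End gaussian_vectors.

(** * The law of an independent pair *)

Lemma ge0_integral_shift {R : realType} (c : R) (f : R -> \bar R) :
  measurable_fun setT f -> (forall x, 0 <= f x)%E ->
  (\int[@lebesgue_measure R]_x f x = \int[@lebesgue_measure R]_x f (x + c)%R)%E.
Proof.
move=> mf f0.
have msh : measurable_fun setT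
    ((fun x => x + c) : measurableTypeR R -> measurableTypeR R).
  have : measurable_fun setT (fun x : R => x + c) by exact: measurable_funD.
  exact.
pose sh : {mfun (measurableTypeR R) >-> (measurableTypeR R)} :=
  HB.pack ((fun x => x + c) : measurableTypeR R -> measurableTypeR R)
    (isMeasurableFun.Build _ _ _ _ _ msh).
have mush (A : set (measurableTypeR R)) : measurable A ->
    pushforward (@lebesgue_measure R) sh A = lebesgue_measure A.
  move=> mA; apply/esym/lebesgue_measure_unique => //= _ [[a b]] _ <-.
  rewrite /pushforward (_ : sh @^-1` _ = `]a - c, b - c]%classic); last first.
    by apply/seteqP; split => x /=; rewrite !in_itv/= ltrBlDr lerBrDr.
  rewrite !lebesgue_measure_itv/= !lte_fin ltrD2r; case: ifPn => // _.
  by rewrite -!EFinB; congr EFin; lra.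
transitivity (\int[pushforward (@lebesgue_measure R) sh]_x f x)%E.
  by apply: eq_measure_integral => A mA _; exact/esym/mush.
by rewrite (ge0_integral_pushforward msh)// preimage_setT.
Qed.

Lemma measurable_fun_halfspaces {T : pointedType} {R : realType}
    (K : set (T -> R)) (z : T -> R) : affine_closed K -> K z ->
  measurable_fun setT (z : g_sigma_algebraType (@rv_halfspaces T R K) -> R).
Proof.
move=> [Kc KD KZ] Kz.
apply: (measurability _ (RGenOInfty.measurableE R)) => //.
move=> _ [_ [a ->] <-]; rewrite setTI.
apply: sub_sigma_algebra; exists (fun x => z x + (- a)); first exact: KD.
by apply/seteqP; split => x /=; rewrite in_itv/= andbT subr_gt0.
Qed.

(** Fubini for an event about X and the outcome w itself, the latter being
    observed through the sub-sigma-algebra <<s G >> only: this replaces a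
    vector of random variables independent of X. *)
Lemma law_of_independent_pair {d} {T : measurableType d} {R : realType}
    (P : probability T R) (G : set (set T)) (X : T -> R) (m s : R)
    (S : set (measurableTypeR R * g_sigma_algebraType G)) :
  (forall A, <<s G >> A -> measurable A) -> measurable_fun setT X ->
  (forall A, measurable A -> P (X @^-1` A) = normal_prob m s A) ->
  (forall A B, measurable A -> <<s G >> B ->
     P (X @^-1` A `&` B) = P (X @^-1` A) * P B)%E ->
  measurable S ->
  measurable_fun setT (fun x : R => P [set w | S (x, w)]) /\
  (P [set w | S (X w, w)] =
   \int[@lebesgue_measure R]_x (P [set w | S (x, w)] * (normal_pdf m s x)%:E))%E.
Proof.
move=> sG mX law ind mS.
have mX' : measurable_fun setT (X : T -> measurableTypeR R) by exact: mX.
have mid : measurable_fun setT (idfun : T -> g_sigma_algebraType G).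
  by move=> _ A mA; rewrite setTI; exact: sG.
have mpair : measurable_fun setT
    ((fun w => (X w, w)) : T -> (measurableTypeR R * g_sigma_algebraType G)%type).
  exact: measurable_fun_pair.
pose idm : {mfun T >-> g_sigma_algebraType G} :=
  HB.pack (idfun : T -> g_sigma_algebraType G) (isMeasurableFun.Build _ _ _ _ _ mid).
pose pairm : {mfun T >-> (measurableTypeR R * g_sigma_algebraType G)%type} :=
  HB.pack ((fun w => (X w, w)) : T -> (measurableTypeR R * g_sigma_algebraType G)%type)
    (isMeasurableFun.Build _ _ _ _ _ mpair).
pose m1 : probability (measurableTypeR R) R := normal_prob m s.
pose m2 := distribution P idm.
have xsE x : m2 (xsection S x) = P [set w | S (x, w)].
  rewrite /m2 /distribution /pushforward/= /xsection.
  by congr (P _)%E; apply/seteqP; split => w /=; rewrite inE.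
have mxs : measurable_fun setT (fun x : measurableTypeR R => P [set w | S (x, w)]).
  rewrite (_ : (fun x => _) = m2 \o xsection S); last first.
    by apply/funext => x; rewrite -xsE.
  exact: measurable_fun_xsection.
split; first exact: mxs.
have := @product_measure_unique _ _ _ _ _ m1 m2 (distribution P pairm).
move=> /(_ _ _ mS) h.
have <- : (m1 \x m2)%E S = P [set w | S (X w, w)].
  rewrite h// => A B mA mB.
  transitivity (normal_prob m s A * P B)%E; last by [].
  rewrite -law//; exact: ind.
rewrite /product_measure1.
rewrite (@ge0_integral_density _ _ _ (@lebesgue_measure R) m1 (normal_pdf m s))//.
- by apply: eq_integral => x _; rewrite /= -xsE.
- exact: measurable_normal_pdf.
- by move=> x; exact: normal_pdf_ge0.
- exact: measurable_fun_xsection.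
Qed.

(** * The faces of a moving orthant *)

Lemma measurable_forall_cmp {d} {T : measurableType d} {R : realType} {p : nat}
    (strict : 'I_p -> bool) (u v : 'I_p -> T -> R) :
  (forall k, measurable_fun setT (u k)) -> (forall k, measurable_fun setT (v k)) ->
  measurable [set x | forall k, if strict k then u k x < v k x else u k x <= v k x].
Proof.
move=> mu mv.
rewrite (_ : [set x | _] = \bigcap_(k in [set: 'I_p])
    [set x | if strict k then u k x < v k x else u k x <= v k x]); last first.
  by apply/seteqP; split => x /= h k; [move=> _; exact: h|exact: h].
apply: fin_bigcap_measurable => [|k _]; first exact: finite_finset.
have mB : measurable_fun setT (fun x => v k x - u k x) by exact: measurable_funB.
case: (strict k).
  rewrite (_ : [set x | _] = (fun x => v k x - u k x) @^-1` `]0, +oo[%classic).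
    by rewrite -[Z in measurable Z]setTI; apply: mB => //; exact: measurable_itv.
  by apply/seteqP; split => x /=; rewrite in_itv/= andbT subr_gt0.
rewrite (_ : [set x | _] = (fun x => v k x - u k x) @^-1` `[0, +oo[%classic).
  by rewrite -[Z in measurable Z]setTI; apply: mB => //; exact: measurable_itv.
by apply/seteqP; split => x /=; rewrite in_itv/= andbT subr_ge0.
Qed.

Lemma measure_ord_bigcup_le {d} {T : measurableType d} {R : realType}
    (P : probability T R) {p : nat} (F : 'I_p -> set T) (A : set T) :
  measurable A -> (forall j, measurable (F j)) ->
  (forall w, A w -> exists j, F j w) -> (P A <= \sum_(j < p) P (F j))%E.
Proof.
move=> mA mF AF.
have [mU hU] : measurable (\big[setU/set0]_(j < p) F j) /\
    (P (\big[setU/set0]_(j < p) F j) <= \sum_(j < p) P (F j))%E.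
  apply: (big_ind2 (fun (B : set T) r => measurable B /\ P B <= r)%E).
  - by rewrite measure0.
  - move=> B1 r1 B2 r2 [mB1 h1] [mB2 h2]; split; first exact: measurableU.
    by apply: (le_trans (measureU2 _ mB1 mB2)); exact: leeD.
  - by move=> j _.
apply: le_trans hU; apply: le_measure; rewrite ?inE//.
by move=> w /AF[j Fjw]; rewrite (bigD1 j)//=; left.
Qed.

(** Ties are broken in favour of the smallest index. *)
Lemma first_argmax {R : realType} {p : nat} (D : 'I_p -> R) (i : 'I_p) :
  exists j : 'I_p, forall k : 'I_p, if (k < j)%N then D k < D j else D k <= D j.
Proof.
have [m _ hm] := @arg_maxP _ _ 'I_p i xpredT D isT.
have {}hm k : D k <= D m by exact: hm.
have Pm : D m == D m by [].
have [j /eqP Dj hj] := @arg_minnP _ m (fun k => D k == D m) (@nat_of_ord p) Pm.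
exists j => k; rewrite Dj; case: ifPn => kj; last exact: hm.
rewrite lt_neqAle hm andbT; apply: contraL kj => /hj.
by rewrite -leqNgt.
Qed.

Section faces.
Context {d} {T : measurableType d} {R : realType} (P : probability T R).
Context {p : nat} (Y : 'I_p -> {RV P >-> R}).
Hypothesis hG : gaussian_vector Y.
Hypothesis hC : centered Y.
Variable y : 'rV[R]_p.

Local Notation e j := (delta_mx ord0 j : 'rV[R]_p).
Local Notation lin := (lincomb P Y).
Local Notation V a b := (cov P Y a b).

Hypothesis var_gt0 : forall j, 0 < V (e j) (e j).

Definition regcoef (k j : 'I_p) : R := V (e k) (e j) / V (e j) (e j).
Definition residual (k j : 'I_p) : 'rV[R]_p := e k - regcoef k j *: e j.

Lemma residual_uncorrelated k j : V (residual k j) (e j) = 0.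
Proof.
rewrite /residual -scaleN1r !(covDl _ _ hG) !(covZl _ _ hG) /regcoef.
by rewrite divfK ?mulN1r ?subrr// gt_eqF.
Qed.

Lemma lin_residual k j w : lin (residual k j) w = Y k w - regcoef k j * Y j w.
Proof. by rewrite lincombD -scaleN1r !lincombZ !lincomb_delta mulN1r. Qed.

(** The product is the squared correlation coefficient. *)
Lemma regcoefM_le1 k j : regcoef k j * regcoef j k <= 1.
Proof.
have := cov_cauchy_schwarz _ _ hG (e k) (e j) (var_gt0 k).
rewrite /regcoef (covC _ _ (e j) (e k)) => h.
rewrite mulrACA -expr2 -invfM mulrC ler_pdivrMl ?mulr_gt0// mulr1.
by rewrite mulrC.
Qed.

Definition axis (j : 'I_p) : set (T -> R) :=
  [set z | exists t g, z = fun w => lin (t *: e j) w + g].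
(** The affine functions of Y that are uncorrelated with Y j, hence, as it will
    turn out, independent of it. *)
Definition residuals (j : 'I_p) : set (T -> R) :=
  [set z | exists b g, V (e j) b = 0 /\ z = fun w => lin b w + g].

Lemma affine_closed_axis j : affine_closed (axis j).
Proof.
split.
- move=> c; exists 0, c; apply/funext => w.
  by rewrite scale0r lincomb0 add0r.
- move=> _ _ [t [g ->]] [t' [g' ->]]; exists (t + t'), (g + g').
  by apply/funext => w; rewrite scalerDl lincombD; ring.
- move=> c _ [t [g ->]]; exists (c * t), (c * g).
  by apply/funext => w; rewrite !lincombZ; ring.
Qed.

Lemma affine_closed_residuals j : affine_closed (residuals j).
Proof.
split.
- move=> c; exists 0, c; split; last by apply/funext => w; rewrite lincomb0 add0r.
  by rewrite -(scale0r (e j)) (covZr _ _ hG) mul0r.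
- move=> _ _ [t [g [h ->]]] [t' [g' [h' ->]]]; exists (t + t'), (g + g').
  split; first by rewrite (covDr _ _ hG) h h' addr0.
  by apply/funext => w; rewrite lincombD; ring.
- move=> c _ [t [g [h ->]]]; exists (c *: t), (c * g).
  split; first by rewrite (covZr _ _ hG) h mulr0.
  by apply/funext => w; rewrite lincombZ; ring.
Qed.

Lemma measurable_lin_cst a g : measurable_fun setT (fun w => lin a w + g).
Proof. by apply: measurable_funD => //; exact: measurable_lincomb. Qed.

Lemma residuals_measurable j A :
  <<s @rv_halfspaces _ _ (residuals j) >> A -> measurable A.
Proof.
move: A; apply: smallest_sub; first exact: sigma_algebra_measurable.
move=> A [_ [b [g [_ ->]]] ->]; rewrite -[X in measurable X]setTI.
rewrite (_ : [set x | _] = (fun w => lin b w + g) @^-1` `]0, +oo[%classic).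
  by apply: measurable_lin_cst => //; exact: measurable_itv.
by apply/seteqP; split => w /=; rewrite in_itv/= andbT.
Qed.

Lemma independent_axis_residuals j A B : measurable A ->
  <<s @rv_halfspaces _ _ (residuals j) >> B ->
  P (Y j @^-1` A `&` B) = (P (Y j @^-1` A) * P B)%E.
Proof.
move=> mA sB.
apply: (@independent_of_cos _ _ _ _ (axis j) (residuals j)) => //.
- exact: affine_closed_axis.
- exact: affine_closed_residuals.
- by move=> _ [t [g ->]]; exact: measurable_lin_cst.
- by move=> _ [t [g [_ ->]]]; exact: measurable_lin_cst.
- move=> _ _ [t [g ->]] [b [h [hb ->]]].
  by apply: Rintegral_cos_uncorrelated => //; rewrite (covZl _ _ hG) hb mulr0.
- have Yj : axis j (Y j).
    by exists 1, 0; apply/funext => w; rewrite scale1r lincomb_delta addr0.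
  have := measurable_fun_halfspaces _ _ (affine_closed_axis j) Yj.
  by move=> /(_ measurableT A mA); rewrite setTI.
Qed.

Definition stdev (j : 'I_p) : R := Num.sqrt (V (e j) (e j)).

Lemma stdev_gt0 j : 0 < stdev j. Proof. by rewrite sqrtr_gt0. Qed.

Lemma law_coordinate j A : measurable A ->
  P (Y j @^-1` A) = normal_prob 0 (stdev j) A.
Proof.
move=> mA; have [s [s0 law vs]] := gaussian_lincomb _ _ hG hC (e j).
have sE : stdev j = s by rewrite /stdev vs sqrtr_sqr ger0_norm.
have := law A mA; rewrite /gaussian_law -sE gt_eqF ?stdev_gt0// => <-.
by congr (P _); apply/seteqP; split => w /=; rewrite lincomb_delta.
Qed.

(** On the event Y j = t + y j, this says that j is the first index where
    Y k - y k is maximal; writing Y k as its residual plus a multiple of Y j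
    frees the condition from Y j. The strict inequalities for k < j attribute a
    face shared by several coordinates to the first of them. *)
Definition face (j : 'I_p) (t : R) : set T := [set w | forall k : 'I_p,
  if (k < j)%N then lin (residual k j) w + regcoef k j * (t + y ord0 j) < y ord0 k + t
  else lin (residual k j) w + regcoef k j * (t + y ord0 j) <= y ord0 k + t].

Lemma residuals_residual k j : residuals j (lin (residual k j)).
Proof.
exists (residual k j), 0; split; last by apply/funext => w; rewrite addr0.
by rewrite covC residual_uncorrelated.
Qed.

Lemma face_sigma j t : <<s @rv_halfspaces _ _ (residuals j) >> (face j t).
Proof.
apply: (@measurable_forall_cmp _ (g_sigma_algebraType (@rv_halfspaces _ _ (residuals j)))
  _ _ (fun k : 'I_p => (k < j)%N)
  (fun k w => lin (residual k j) w + regcoef k j * (t + y ord0 j))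
  (fun k w => y ord0 k + t)) => // k.
apply: measurable_funD => //.
apply: measurable_fun_halfspaces; first exact: affine_closed_residuals.
exact: residuals_residual.
Qed.

Lemma measurable_face j t : measurable (face j t).
Proof. by apply: residuals_measurable; exact: face_sigma. Qed.

Lemma measurable_tail j (t : R) : measurable (Y j @^-1` `]t + y ord0 j, +oo[%classic).
Proof. by rewrite -[X in measurable X]setTI; apply: measurable_funP. Qed.

(** In the geometry of the covariance, the points beyond the hyperplane
    Y j = t + y j whose orthogonal projection on it lies in the face. *)
Definition face_prism j t := Y j @^-1` `]t + y ord0 j, +oo[%classic `&` face j t.

(** Let a and b be the positive excesses of Y j and Y k over t + y j and
    t + y k. The prism over face j gives b < c k j * a and the one over face k
    gives a <= c j k * b, which is absurd because c k j * c j k <= 1. *)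
Lemma face_prism_disjoint t (j k : 'I_p) w : (k < j)%N ->
  face_prism j t w -> face_prism k t w -> False.
Proof.
move=> kj [/= utj /(_ k)] + [/= vtk /(_ j)]; move: utj vtk.
rewrite kj ltnNge (ltnW kj)/= !lin_residual !in_itv/= !andbT.
set u := Y j w; set v := Y k w.
have := regcoefM_le1 k j.
set ckj := regcoef k j; set cjk := regcoef j k => cc ut vt hj hk.
have h1 : v - t - y ord0 k < ckj * (u - t - y ord0 j) by lra.
have h2 : u - t - y ord0 j <= cjk * (v - t - y ord0 k) by lra.
have u0 : 0 < u - t - y ord0 j by lra.
have v0 : 0 < v - t - y ord0 k by lra.
move: h1 h2 u0 v0; set a := u - t - y ord0 j; set b := v - t - y ord0 k.
move=> h1 h2 a0 b0.
have c0 : 0 < ckj.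
  by have : 0 < ckj * a by [apply: lt_trans h1]; rewrite pmulr_lgt0.
have : ckj * a <= ckj * (cjk * b) by rewrite ler_pM2l.
have : (ckj * cjk) * b <= 1 * b by rewrite ler_pM2r.
by rewrite -mulrA; lra.
Qed.

Lemma sum_face_prism t : (\sum_(j < p) P (face_prism j t) <= 1)%E.
Proof.
have mN j : measurable (face_prism j t).
  by apply: measurableI; [exact: measurable_tail|exact: measurable_face].
rewrite -measure_bigsetU_ord//.
  by apply: probability_le1; exact: bigsetU_measurable.
move=> j k _ _ [w [wj wk]].
have [jk|kj|/val_inj//] := ltngtP j k; exfalso.
  exact: (@face_prism_disjoint t k j w).
exact: (@face_prism_disjoint t j k w).
Qed.

Variable sigma : R.
Hypothesis sigma0 : 0 < sigma.
Hypothesis sigma_le : forall j, sigma <= stdev j.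
Hypothesis p_gt0 : (0 < p)%N.

Local Notation a := (Num.sqrt (2 * ln p%:R) : R).

(** At a distance of more than a * stdev j from the mean, the exponential factor
    of the density is at most exp(- a ^ 2 / 2) = 1 / p. *)
Lemma far_density_le j x : a * stdev j < x ->
  normal_pdf 0 (stdev j) x <= (sigma * p%:R)^-1.
Proof.
move=> ax; have s0 := stdev_gt0 j; have sn0 : stdev j != 0 by rewrite gt_eqF.
have p0 : 0 < p%:R :> R by rewrite ltr0n.
have lnp : 0 <= ln p%:R :> R by rewrite ln_ge0// ler1n.
have a0 : 0 <= a by [].
have x2 : 2 * ln p%:R * stdev j ^+ 2 <= x ^+ 2.
  have as0 : 0 <= a * stdev j by rewrite mulr_ge0// ltW.
  have x0 : 0 <= x by exact: le_trans as0 (ltW ax).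
  rewrite -[2 * ln _]sqr_sqrtr ?mulr_ge0// -exprMn ler_sqr ?nnegrE//.
  exact: ltW.
(* 2 pi >= 1 *)
have peak : normal_peak (stdev j) <= sigma^-1.
  rewrite /normal_peak lef_pV2 ?posrE ?sqrtr_gt0//; last first.
    by rewrite mulrn_wgt0// mulr_gt0 ?exprn_gt0 ?pi_gt0.
  apply: (le_trans (sigma_le j)).
  rewrite -[leLHS](ger0_norm (ltW s0)) -sqrtr_sqr ler_sqrt; last first.
    by rewrite mulrn_wge0// mulr_ge0 ?sqr_ge0 ?pi_ge0.
  rewrite -mulrnAr ler_peMr ?sqr_ge0//.
  by have := @pi_ge2 R; rewrite mulr2n; lra.
rewrite normal_pdfE// invfM; apply: ler_pM => //.
- exact: normal_peak_ge0.
- exact: normal_fun_ge0.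
rewrite -[leRHS]lnK ?posrE ?invr_gt0// lnV ?posrE//.
rewrite ler_expR subr0 mulNr lerN2.
rewrite ler_pdivlMr ?pmulrn_lgt0 ?exprn_gt0//.
by rewrite mulrnAr -mulr_natl mulrA.
Qed.

(** Below the level a * stdev j, the Mills bound and the independence of Y j and
    the face yield the first term; above it, the second term suffices. *)
Lemma face_density_le j t :
  (P (face j t) * (normal_pdf 0 (stdev j) (t + y ord0 j))%:E <=
   ((a + 1) / sigma)%:E * P (face_prism j t) + ((sigma * p%:R)^-1)%:E)%E.
Proof.
have s0 := stdev_gt0 j.
have p0 : 0 < p%:R :> R by rewrite ltr0n.
have a0 : 0 <= a by [].
have a1 : 0 <= (a + 1) / sigma by rewrite divr_ge0 ?addr_ge0// ltW.
have [near|far] := leP (t + y ord0 j) (a * stdev j).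
  apply: (@le_trans _ _ (((a + 1) / sigma)%:E * P (face_prism j t))%E); last first.
    by rewrite leeDl// lee_fin invr_ge0 mulr_ge0// ltW.
  rewrite independent_axis_residuals//; last exact: face_sigma.
  rewrite law_coordinate// muleCA [leLHS]muleC [leRHS]muleC.
  rewrite [leRHS]muleAC lee_wpmul2r//.
  apply: (le_trans (normal_pdf_le_tail _ _ _ s0 a0 near)).
  rewrite lee_wpmul2r// lee_fin ler_wpM2l ?addr_ge0//.
  by rewrite lef_pV2 ?posrE.
apply: (@le_trans _ _ ((sigma * p%:R)^-1)%:E); last first.
  by rewrite leeDr// mule_ge0// lee_fin.
apply: (@le_trans _ _ (1 * (normal_pdf 0 (stdev j) (t + y ord0 j))%:E)%E).
  rewrite lee_wpmul2r ?lee_fin ?normal_pdf_ge0//.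
  by apply: probability_le1; exact: measurable_face.
by rewrite mul1e lee_fin; exact: far_density_le.
Qed.

Lemma sum_face_density_le t :
  (\sum_(j < p) P (face j t) * (normal_pdf 0 (stdev j) (t + y ord0 j))%:E <=
   ((a + 2) / sigma)%:E)%E.
Proof.
have p0 : p%:R != 0 :> R by rewrite pnatr_eq0 -lt0n.
apply: (le_trans (lee_sum _ (fun j _ => face_density_le j t))).
rewrite big_split/= -ge0_sume_distrr; last by [].
apply: (@le_trans _ _ (((a + 1) / sigma)%:E * 1 + (sigma^-1)%:E)%E).
  apply: leeD.
    apply: lee_wpmul2l; last exact: sum_face_prism.
    by rewrite lee_fin divr_ge0 ?addr_ge0// ltW.
  rewrite sumEFin lee_fin sumr_const card_ord -[leLHS]mulr_natr invfM -mulrA.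
  by rewrite mulVf// mulr1.
by rewrite mule1 -EFinD lee_fin; lra.
Qed.


Variable delta : R.
Hypothesis delta0 : 0 < delta.

(** The pairs (x, w) such that 0 < x - y j <= delta and w belongs to the face j
    at level x - y j; evaluated at x = Y j w, the outcomes where the maximum
    of Y k - y k lies in ]0, delta] and is first attained at j. *)
Definition slab j : set (R * T) := [set q |
  0 < q.1 - y ord0 j <= delta /\ forall k : 'I_p,
  if (k < j)%N then lin (residual k j) q.2 + regcoef k j * q.1 <
                      y ord0 k + (q.1 - y ord0 j)
  else lin (residual k j) q.2 + regcoef k j * q.1 <= y ord0 k + (q.1 - y ord0 j)].

Lemma measurable_slab_of {d'} {T' : measurableType d'} j (X : T' -> R)
    (r : 'I_p -> T' -> R) :
  measurable_fun setT X -> (forall k, measurable_fun setT (r k)) ->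
  measurable [set q | 0 < X q - y ord0 j <= delta /\ forall k : 'I_p,
    if (k < j)%N then r k q + regcoef k j * X q < y ord0 k + (X q - y ord0 j)
    else r k q + regcoef k j * X q <= y ord0 k + (X q - y ord0 j)].
Proof.
move=> mX mr.
have mB : measurable_fun setT (fun q => X q - y ord0 j) by exact: measurable_funB.
have mA : measurable [set q | 0 < X q - y ord0 j <= delta].
  rewrite (_ : [set q | _] = (fun q => X q - y ord0 j) @^-1` `]0, delta]%classic).
    by rewrite -[Z in measurable Z]setTI; apply: mB => //; exact: measurable_itv.
  by apply/seteqP; split => q /=; rewrite in_itv.
apply: measurableI; first exact: mA.
apply: (@measurable_forall_cmp _ _ _ _ (fun k : 'I_p => (k < j)%N)
  (fun k q => r k q + regcoef k j * X q)
  (fun k q => y ord0 k + (X q - y ord0 j))) => k.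
- by apply: measurable_funD => //; exact: measurable_funM.
- exact: measurable_funD.
Qed.

Lemma measurable_slab j : measurable
  (slab j : set (measurableTypeR R *
     g_sigma_algebraType (@rv_halfspaces _ _ (residuals j)))).
Proof.
set TL := g_sigma_algebraType (@rv_halfspaces _ _ (residuals j)).
apply: (@measurable_slab_of _ (measurableTypeR R * TL)%type j
  (fun q => (q.1 : R)) (fun k q => lin (residual k j) q.2)) => [|k].
  exact: measurable_fst.
apply: (measurableT_comp (f := (lin (residual k j) : TL -> R))).
  apply: measurable_fun_halfspaces; first exact: affine_closed_residuals.
  exact: residuals_residual.
exact: measurable_snd.
Qed.

Lemma slab_face j t :
  [set w | slab j (t + y ord0 j, w)] `<=` face j t.
Proof. by move=> w [_ /=]; rewrite addrK. Qed.

Lemma measurable_slab_section j x : measurable [set w | slab j (x, w)].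
Proof.
apply: residuals_measurable.
rewrite (_ : [set w | _] = xsection (slab j) x).
  exact: measurable_xsection x (measurable_slab j).
by rewrite /xsection; apply/seteqP; split => w /=; rewrite inE.
Qed.

(** Conditioning on Y j and changing x into t + y j expresses all the slabs as
    integrals over the same variable t in ]0, delta], on which
    [sum_face_density_le] applies pointwise. *)
Lemma sum_slab_le :
  (\sum_(j < p) P [set w | slab j (Y j w, w)] <= (delta * ((a + 2) / sigma))%:E)%E.
Proof.
pose f j (t : R) := (P [set w | slab j ((t + y ord0 j)%R, w)] *
  (normal_pdf 0 (stdev j) (t + y ord0 j))%:E)%E.
have hj j : measurable_fun setT (f j) /\
    P [set w | slab j (Y j w, w)] = (\int[@lebesgue_measure R]_t f j t)%E.
  have [mf ->] := law_of_independent_pair P _ (Y j) 0 (stdev j) _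
    (@residuals_measurable j) (@measurable_funP _ _ _ _ setT (Y j)) (law_coordinate j)
    (independent_axis_residuals j) (measurable_slab j).
  have mg : measurable_fun setT (fun x : R =>
      P [set w | slab j (x, w)] * (normal_pdf 0 (stdev j) x)%:E)%E.
    apply: emeasurable_funM => //; apply/measurable_EFinP.
    exact: measurable_normal_pdf.
  split.
    apply: (measurableT_comp mg); exact: measurable_funD.
  rewrite (ge0_integral_shift (y ord0 j))// => x.
  by rewrite mule_ge0// lee_fin normal_pdf_ge0.
have f0 j t : (0 <= f j t)%E by rewrite mule_ge0// lee_fin normal_pdf_ge0.
under eq_bigr do rewrite (hj _).2.
rewrite -ge0_integral_sum//; last by move=> j; exact: (hj j).1.
rewrite (_ : (delta * ((a + 2) / sigma))%:E =
    \int[@lebesgue_measure R]_(t in `]0%R, delta]) ((a + 2) / sigma)%:E)%E; last first.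
  rewrite integral_cst//= lebesgue_measure_itv/= lte_fin delta0 -EFinB subr0.
  by rewrite -EFinM mulrC.
rewrite [leRHS]integral_mkcond; apply: ge0_le_integral => //.
- by move=> t _; apply: sume_ge0 => j _.
- by apply: emeasurable_sum => j; exact: (hj j).1.
- apply/(measurable_restrictT _ _).1 => //; exact: measurable_itv.
- move=> t _; rewrite patchE; case: ifPn => [_|].
    apply: le_trans (sum_face_density_le t); apply: lee_sum => j _.
    rewrite /f lee_wpmul2r ?lee_fin ?normal_pdf_ge0//.
    apply: le_measure; rewrite ?inE.
    + exact: measurable_slab_section.
    + exact: measurable_face.
    + exact: slab_face.
  rewrite notin_setE/= in_itv/= => nt; rewrite big1// => j _.
  rewrite /f (_ : [set w | _] = set0) ?measure0 ?mul0e//.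
  by apply/seteqP; split => w //= [/=]; rewrite addrK => /nt.
Qed.

Lemma increment_slab w :
  (forall j, Y j w <= y ord0 j + delta) -> ~ (forall j, Y j w <= y ord0 j) ->
  exists j, slab j (Y j w, w).
Proof.
move=> hle hgt.
have [i hi] : exists i, y ord0 i < Y i w.
  apply: contrapT => h; apply: hgt => j; rewrite leNgt; apply/negP => hj.
  by apply: h; exists j.
have [j hj] := first_argmax (fun k => Y k w - y ord0 k) i.
exists j; split => /=.
  have hij : Y i w - y ord0 i <= Y j w - y ord0 j.
    by have := hj i; case: ifP => // _ /ltW.
  by have := hle j => hlej; apply/andP; split; lra.
move=> k; have := hj k; rewrite lin_residual.
by case: ifP => _ h; lra.
Qed.

Lemma increment_le :
  (P [set w | forall j, (Y j w <= y ord0 j + delta)%R]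
   - P [set w | forall j, (Y j w <= y ord0 j)%R]
   <= (delta * ((a + 2) / sigma))%:E)%E.
Proof.
have mle (c : R) : measurable [set w | forall j, (Y j w <= y ord0 j + c)%R].
  exact: (@measurable_forall_cmp _ _ _ _ (fun=> false) (fun j w => Y j w)
    (fun j w => y ord0 j + c)).
have m0 : measurable [set w | forall j, (Y j w <= y ord0 j)%R].
  by have := mle 0; congr measurable; apply/seteqP; split => w /= h j;
    have := h j; rewrite addr0.
have sub : [set w | forall j, (Y j w <= y ord0 j)%R] `<=`
    [set w | forall j, (Y j w <= y ord0 j + delta)%R].
  by move=> w h j; apply: (le_trans (h j)); rewrite lerDl ltW.
have -> : (P [set w | forall j, (Y j w <= y ord0 j + delta)%R]
   - P [set w | forall j, (Y j w <= y ord0 j)%R] =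
   P ([set w | forall j, (Y j w <= y ord0 j + delta)%R] `\`
      [set w | forall j, (Y j w <= y ord0 j)%R]))%E.
  rewrite measureD//.
    by rewrite setIidr.
  by rewrite (le_lt_trans (probability_le1 _ _)) ?ltry.
apply: le_trans sum_slab_le; apply: measure_ord_bigcup_le.
- exact: measurableD.
- move=> j; apply: measurable_slab_of => // k; exact: measurable_lincomb.
- by move=> w [h1 h2]; exact: increment_slab.
Qed.

End faces.

Theorem theorem1 (d : measure_display) (T : measurableType d) (R : realType)
    (P : probability T R) (p : nat) (hp : (1 <= p)%N)
    (Y : 'I_p -> {RV P >-> R})
    (hG : gaussian_vector Y) (hC : centered Y)
    (sigma : R) (hsigma : 0 < sigma)
    (hvar : forall j : 'I_p,
       ((sigma ^+ 2)%:E <= 'E_P[fun omega => (Y j omega ^+ 2)%R])%E)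
    (y : 'rV[R]_p) (delta : R) (hdelta : 0 < delta) :
  (P [set omega | forall j : 'I_p, (Y j omega <= y ord0 j + delta)%R]
   - P [set omega | forall j : 'I_p, (Y j omega <= y ord0 j)%R]
   <= (delta / sigma * (Num.sqrt (2 * ln p%:R) + 2))%:E)%E.
Proof.
have var_ge j : sigma ^+ 2 <= cov P Y (delta_mx ord0 j) (delta_mx ord0 j).
  have i2 := integrable_lincombM P Y hG (delta_mx ord0 j) (delta_mx ord0 j).
  rewrite -lee_fin /cov /Rintegral fineK; last exact: integrable_fin_num.
  apply: (le_trans (hvar j)); rewrite unlock.
  under [leRHS]eq_integral do rewrite lincomb_delta -expr2.
  exact: lexx.
have var_gt0 j : 0 < cov P Y (delta_mx ord0 j) (delta_mx ord0 j).
  by apply: lt_le_trans (var_ge j); rewrite exprn_gt0.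
have sigma_le j : sigma <= stdev P Y j.
  by rewrite -[leLHS](ger0_norm (ltW hsigma)) -sqrtr_sqr ler_sqrt ?(ltW (var_gt0 j)).
rewrite mulrAC -[in leRHS]mulrA.
exact: (increment_le P Y hG hC y var_gt0 sigma hsigma sigma_le hp delta hdelta).
Qed.
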